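(* For $\alpha\in\mathbb{C}$, $\alpha\neq 0$, let $\mathfrak{g}_I(\alpha)$ be the $7$-dimensional complex filiform Lie algebra with basis $(x_1,\ldots,x_7)$ and brackets \[ [x_1,x_i]=x_{i+1}\ (2\le i\le 6),\quad [x_2,x_3]=x_5,\quad [x_2,x_4]=x_6,\quad [x_2,x_5]=(1-\alpha)x_7,\quad [x_3,x_4]=\alpha x_7, \] all brackets of basis vectors not determined by these and skew-symmetry being zero. Then every complex filiform Lie algebra of dimension $n\le 7$ that is not isomorphic to any of the algebras $\mathfrak{g}_I(\alpha)$, $\alpha\ne 0$, admits a Novikov structure. Moreover, for $\alpha\neq 0$, the algebra $\mathfrak{g}_I(\alpha)$ admits a Novikov structure if and only if $\alpha=\frac{1}{10}$.
   Context: A Lie algebra $\mathfrak{g}$ is called $p$-step nilpotent if $\mathfrak{g}^{p+1}=0$, where $\mathfrak{g}^1=\mathfrak{g}$ and $\mathfrak{g}^{i+1}=[\mathfrak{g},\mathfrak{g}^i]$. A filiform nilpotent Lie algebra is a nilpotent Lie algebra of dimension $n$ whose nilpotency class is exactly $p=n-1$. A Novikov structure on a Lie algebra $\mathfrak{g}$ over $\mathbb{C}$ is a $\mathbb{C}$-bilinear product $(x,y)\mapsto x\cdot y$ on $\mathfrak{g}$ satisfying, for all $x,y,z\in\mathfrak{g}$: $x\cdot(y\cdot z)-(x\cdot y)\cdot z=y\cdot(x\cdot z)-(y\cdot x)\cdot z$ (left-symmetry), $(x\cdot y)\cdot z=(x\cdot z)\cdot y$, and $[x,y]=x\cdot y-y\cdot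 x$. *)

(* Defs.v *)
From HB Require Import structures.
From mathcomp Require Import all_boot all_order all_algebra sesquilinear.
From mathcomp Require Import ring.

Set Implicit Arguments.
Unset Strict Implicit.
Unset Printing Implicit Defensive.

Import GRing.Theory.
Local Open Scope ring_scope.

Record lieAlgebra (F : fieldType) := LieAlgebra {
  lie_sort :> vectType F;
  lie_bracket : {bilinear lie_sort -> lie_sort -> lie_sort};
  _ : forall x, lie_bracket x x = 0;
  _ : forall x y z,
        lie_bracket x (lie_bracket y z) + lie_bracket y (lie_bracket z x)
        + lie_bracket z (lie_bracket x y) = 0
}.

Arguments lie_bracket {F l}.

Declare Scope lie_scope.
Delimit Scope lie_scope with lie.
Notation "[< x , y >]" := (lie_bracket x y)
  (at level 0, format "[<  x ,  y  >]") : lie_scope.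
Local Open Scope lie_scope.

Section LieTheory.

Variables (F : fieldType) (g : lieAlgebra F).
Implicit Types (x y z : g) (U V W : {vspace g}).

Lemma lie_alt x : [< x, x >] = 0.
Proof. by case: g x. Qed.

Lemma lie_jacobi x y z :
  [< x, [< y, z >] >] + [< y, [< z, x >] >] + [< z, [< x, y >] >] = 0.
Proof. by case: g x y z. Qed.

(* The span of all brackets of elements of U and V. As for the product prodv of
   subspaces of an algebra, brackets of basis vectors suffice: see lieprodP. *)
Definition lieprod U V : {vspace g} :=
  <<[seq [< x, y >] | x <- vbasis U, y <- vbasis V]>>%VS.

Lemma memv_lie U V x y : x \in U -> y \in V -> [< x, y >] \in lieprod U V.
Proof.
move=> Ux Vy; rewrite (coord_vbasis Ux) linear_sumlz; apply: memv_suml => i _.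
rewrite linearZl_LR memvZ // (coord_vbasis Vy) linear_sumr.
apply: memv_suml => j _; rewrite linearZr_LR memvZ //.
by apply/memv_span/allpairs_f; rewrite mem_nth ?size_tuple.
Qed.

Lemma lieprodP U V W :
  reflect (forall x y, x \in U -> y \in V -> [< x, y >] \in W)
          (lieprod U V <= W)%VS.
Proof.
apply: (iffP idP) => [sUVW x y Ux Vy | sUVW].
  exact: (subvP sUVW) _ (memv_lie Ux Vy).
apply/span_subvP => _ /allpairsP[[x y] [/= /vbasis_mem Ux /vbasis_mem Vy ->]].
exact: sUVW.
Qed.

(* lcs i is g^i for i >= 1, with g^1 = g; the value g at i = 0 is junk. *)
Fixpoint lcs (i : nat) : {vspace g} :=
  if i is i'.+1 then (if i' is 0 then fullv else lieprod fullv (lcs i'))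
  else fullv.

Definition step_nilpotent (p : nat) : Prop := lcs p.+1 = 0%VS.

Definition nilpotency_class (p : nat) : Prop :=
  step_nilpotent p /\ forall q, (q < p)%N -> ~ step_nilpotent q.

(* The dimension is written p + 1 to avoid truncated subtraction. *)
Definition filiform : Prop :=
  exists2 p, \dim {:g} = p.+1 & nilpotency_class p.

Definition is_novikov_structure (mul : {bilinear g -> g -> g}) : Prop :=
  [/\ forall x y z, mul x (mul y z) - mul (mul x y) z
                    = mul y (mul x z) - mul (mul y x) z,
      forall x y z, mul (mul x y) z = mul (mul x z) y
    & forall x y, [< x, y >] = mul x y - mul y x].

Definition admits_novikov_structure : Prop :=
  exists mul : {bilinear g -> g -> g}, is_novikov_structure mul.

End LieTheory.

Arguments lie_alt {F g} x.
Arguments lie_jacobi {F g} x y z.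
Arguments step_nilpotent {F} g p.
Arguments nilpotency_class {F} g p.
Arguments filiform {F} g.
Arguments admits_novikov_structure {F} g.

Definition lie_isomorphic (F : fieldType) (g h : lieAlgebra F) : Prop :=
  exists f : {linear g -> h},
    bijective f /\ forall x y : g, f [< x, y >] = [< f x, f y >].

Section FamilyI.

Variables (F : fieldType) (a : F).

(* The standard basis x_1, ..., x_7, numbered from 1. *)
Definition gI_basis (i : nat) : 'rV[F]_7 := delta_mx 0 (inord i.-1).
Local Notation x i := (gI_basis i%N).

(* [x_i, x_j] for 1 <= i < j <= 7; not meaningful for other i, j. *)
Definition gI_table (i j : nat) : 'rV[F]_7 :=
  match i, j with
  | 1%N, (2 | 3 | 4 | 5 | 6)%N => x j.+1
  | 2%N, 3%N => x 5
  | 2%N, 4%N => x 6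
  | 2%N, 5%N => (1 - a) *: x 7
  | 3%N, 4%N => a *: x 7
  | _, _ => 0
  end.

Definition gI_bracket (u v : 'rV[F]_7) : 'rV[F]_7 :=
  \sum_(i < 7) \sum_(j < 7 | (i < j)%N)
    (u 0 i * v 0 j - u 0 j * v 0 i) *: gI_table i.+1 j.+1.

Lemma gI_bracket_basis (i j : nat) :
  (1 <= i < j)%N -> (j <= 7)%N -> gI_bracket (x i) (x j) = gI_table i j.
Proof.
case: i j => [|i] [|j] // /andP[_]; rewrite !ltnS => ltij lej6.
have ltj7 : (j < 7)%N := lej6; have lti7 := ltn_trans ltij ltj7.
have xE k l (ltk7 : (k < 7)%N) : x k.+1 0 l = (l == Ordinal ltk7)%:R.
  by rewrite mxE eqxx /=; congr (_ == _)%:R; apply/val_inj; rewrite /= inordK.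
rewrite /gI_bracket (bigD1 (Ordinal lti7)) //= (bigD1 (Ordinal ltj7)) //=.
rewrite !(xE i _ lti7) !(xE j _ ltj7) !eqxx /= -[Ordinal ltj7 == _]val_eqE /=.
rewrite gtn_eqF // mul0r subr0 mulr1 scale1r !big1 ?addr0 //.
  move=> k neki; rewrite big1 // => l ltkl.
  rewrite !(xE i _ lti7) !(xE j _ ltj7) (negPf neki) mul0r sub0r.
  have [eli|] := eqVneq l (Ordinal lti7); last by rewrite mul0r oppr0 scale0r.
  rewrite eli in ltkl; have [ekj|] := eqVneq k (Ordinal ltj7).
    by move: ltkl; rewrite ekj /= ltnNge ltnW.
  by rewrite mulr0 oppr0 scale0r.
move=> l /andP[ltil nelj].
rewrite !(xE i _ lti7) !(xE j _ ltj7) (negPf nelj) mulr0 sub0r.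
by rewrite -[l == _]val_eqE /= gtn_eqF // mul0r oppr0 scale0r.
Qed.

Fact gI_bracket_bilinear :
  bilinear_for (GRing.Scale.Law.clone _ _ *:%R _)
               (GRing.Scale.Law.clone _ _ *:%R _) gI_bracket.
Proof.
split=> w c u v; rewrite /= /gI_bracket scaler_sumr -big_split;
  apply: eq_bigr => i _;
  rewrite scaler_sumr -big_split; apply: eq_bigr => j _ /=;
  by rewrite scalerA -scalerDl !mxE; congr (_ *: _); ring.
Qed.

HB.instance Definition _ :=
  bilinear_isBilinear.Build F 'rV[F]_7 'rV[F]_7 'rV[F]_7 _ _ gI_bracket
    gI_bracket_bilinear.

Fact gI_bracket_alt u : gI_bracket u u = 0.
Proof.
rewrite /gI_bracket big1 // => i _; rewrite big1 // => j _.
by rewrite [u 0 j * _]mulrC subrr scale0r.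
Qed.

Fact gI_bracket_jacobi u v w :
  gI_bracket u (gI_bracket v w) + gI_bracket v (gI_bracket w u)
  + gI_bracket w (gI_bracket u v) = 0.
Proof.
pose d (u v : 'rV[F]_7) (i j : nat) :=
  u 0 (inord i) * v 0 (inord j) - u 0 (inord j) * v 0 (inord i).
have dE (s t : 'rV[F]_7) (i j : 'I_7) :
    s 0 i * t 0 j - s 0 j * t 0 i = d s t i j.
  by rewrite /d !inord_val.
have brE s t : gI_bracket s t =
  d s t 0%N 1%N *: x 3 + d s t 0%N 2%N *: x 4 + d s t 0%N 3%N *: x 5
  + d s t 0%N 4%N *: x 6 + d s t 0%N 5%N *: x 7 + d s t 1%N 2%N *: x 5
  + d s t 1%N 3%N *: x 6 + (d s t 1%N 4%N * (1 - a)) *: x 7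
  + (d s t 2%N 3%N * a) *: x 7.
  rewrite /gI_bracket.
  under eq_bigr => i _ do under eq_bigr => j _ do rewrite dE.
  under eq_bigr => i _ do rewrite big_mkcond /=.
  rewrite !big_ord_recl !big_ord0 /= /bump /= !scaler0 !addr0 !add0r.
  by rewrite !scalerA !addrA.
have xE k l : (k < 7)%N -> (l < 7)%N -> x k.+1 0 (inord l) = (k == l)%:R.
  by move=> hk hl; rewrite mxE eqxx /= -val_eqE /= !inordK // eq_sym.
have cE s t k : (k < 7)%N -> gI_bracket s t 0 (inord k) =
  d s t 0%N 1%N * (2 == k)%N%:R + d s t 0%N 2%N * (3 == k)%N%:R
  + d s t 0%N 3%N * (4 == k)%N%:R + d s t 0%N 4%N * (5 == k)%N%:R
  + d s t 0%N 5%N * (6 == k)%N%:R + d s t 1%N 2%N * (4 == k)%N%:R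
  + d s t 1%N 3%N * (5 == k)%N%:R + d s t 1%N 4%N * (1 - a) * (6 == k)%N%:R
  + d s t 2%N 3%N * a * (6 == k)%N%:R.
  move=> hk; rewrite brE; do ?[rewrite [LHS]mxE; congr (_ + _)];
  by rewrite mxE xE.
pose b s t k : F :=
  match k with
  | 2%N => d s t 0%N 1%N
  | 3%N => d s t 0%N 2%N
  | 4%N => d s t 0%N 3%N + d s t 1%N 2%N
  | 5%N => d s t 0%N 4%N + d s t 1%N 3%N
  | 6%N => d s t 0%N 5%N + d s t 1%N 4%N * (1 - a) + d s t 2%N 3%N * a
  | _ => 0
  end.
have bE s t k : (k < 7)%N -> gI_bracket s t 0 (inord k) = b s t k.
  move=> ltk7; rewrite cE // /b; move: (d s t) => e.
  by case: k ltk7 => [|[|[|[|[|[|[|k]]]]]]] //= _; ring.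
have dbE r s t i j : (i < 7)%N -> (j < 7)%N -> d r (gI_bracket s t) i j =
    r 0 (inord i) * b s t j - r 0 (inord j) * b s t i.
  by move=> lti7 ltj7; rewrite /d !bE.
apply/rowP => k; rewrite -(inord_val k) [LHS]mxE [X in X + _]mxE [RHS]mxE.
case: k => [k ltk7]; rewrite !bE // /b /=.
case: k ltk7 => [|[|[|[|[|[|[|k]]]]]]] //= _; rewrite ?dbE // /b /d /=; ring.
Qed.

Definition gI : lieAlgebra F :=
  @LieAlgebra F 'rV[F]_7 gI_bracket gI_bracket_alt gI_bracket_jacobi.

End FamilyI.

(* Main.v *)
From HB Require Import structures.
Require Import Defs.
From mathcomp Require Import all_boot all_order all_algebra.
From mathcomp Require Import reals complex.
From mathcomp Require Import sesquilinear ring zify.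
Set Implicit Arguments.
Unset Strict Implicit.
Unset Printing Implicit Defensive.
Import GRing.Theory Num.Theory.
Local Open Scope ring_scope.
Local Open Scope lie_scope.

(** Let g be a filiform Lie algebra of dimension n = p + 1. All quotients
    g^i / g^(i+1) with i >= 2 are lines, so that a generic x_1 and a suitable x_2
    give a basis x_1, x_2, x_(i+1) = [x_1, x_i] with [x_2, x_3] in g^4
    ([filiform_adapted], [ladder_basis]). The Jacobi identity then leaves few
    free constants. For n <= 5 the derived algebra is abelian; for n = 6
      [x_2, x_3] = a x_5 + b x_6,  [x_2, x_4] = a x_6,
      [x_2, x_5] = - [x_3, x_4] = c x_6,
    and for n = 7
      [x_2, x_3] = a x_5 + b x_6 + c x_7,  [x_2, x_4] = a x_6 + b x_7,
      [x_2, x_5] = d x_7,  [x_3, x_4] = (a - d) x_7.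

    Novikov structures come from the ansatz in which x_1 acts on the left by
    ad x_1 and trivially on the right; the left multiplications by the other x_i
    are then iterated commutators of ad x_1 with the left multiplication E by
    x_2. If [g, g] is abelian, one can take E equal to ad x_2 on [g, g], choose
    x_2 x_2 such that E commutes with ad x_1, and let [g, g] act by zero
    ([metabelian_novikov]). This settles n <= 5, and n = 7 with a = d. Explicit
    products settle n = 6, and n = 7 with a = 0 ([novikov6], [novikov7]). In the
    remaining case a <> 0, a <> d, replacing x_1 by x_1 + s x_2 and x_2 by
    (x_2 + q x_4) / a removes b and c and scales a to 1: the algebra is
    g_I((a - d) / a) ([normal_bracket7]).

    As to g_I(alpha), the axioms imply that every right multiplication D is a
    half derivation, 2 D[x, y] = [D x, y] + [x, D y]
    ([novikov_half_derivation]). A half derivation is determined by its values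
    at x_1 and x_2, and the grading of g_I(alpha), where x_i has degree i, splits
    the conditions into small linear systems: in degree 0 only scalars survive,
    in degree 1 there is a nonzero solution only if 10 alpha = 1, and in degree 2
    the solutions form a line ([half_derivation_gI]). So if 10 alpha <> 1, the
    right multiplications by x_1, x_2, x_3 start in degrees 2, 2, 3, and the
    leading terms of the last two depend only on v, the coefficient of x_4 in
    x_2 x_2, subject to (v - 1)(1 - 6 alpha) = 8 alpha. The relation
    (x_2 x_2) x_3 = (x_2 x_3) x_2 gives a quadratic equation in v which, together
    with the linear one, forces v = 3 and hence 10 alpha = 1 after all
    ([novikov_parameter]). Conversely an explicit product exists for that
    parameter ([novikov7_tenth]). *)



(** * Identities between vectors and brackets *)

Section VectorIdentities.
Variables (F : fieldType) (V : vectType F).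
Implicit Types u v : V.
Local Notation co j u := (coord (vbasis {:V}) j u).

Lemma eq_vcoord u v : (forall j, co j u = co j v) -> u = v.
Proof.
move=> uv; rewrite (coord_vbasis (memvf u)) (coord_vbasis (memvf v)).
by apply: eq_bigr => j _; rewrite uv.
Qed.

Lemma vcoord0 j : co j (0 : V) = 0. Proof. exact: linear0. Qed.
Lemma vcoordD j u v : co j (u + v) = co j u + co j v.
Proof. exact: linearD. Qed.
Lemma vcoordN j u : co j (- u) = - co j u. Proof. exact: linearN. Qed.
Lemma vcoordZ j k u : co j (k *: u) = k * co j u. Proof. exact: linearZ. Qed.

(** Proves u = v from a = b by naming the scalar k with u - v = k (a - b), a
    certificate that [vring] can check. *)
Lemma eq_of_multiple k u v a b : a = b -> u - v = k *: (a - b) -> u = v.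
Proof. by move=> -> /eqP; rewrite subrr scaler0 subr_eq0 => /eqP. Qed.

Definition vcoordE := (vcoord0, vcoordD, vcoordN, vcoordZ).
End VectorIdentities.

(** An identity between linear combinations of vectors is an identity between
    their coordinates in some basis, where it can be decided as a ring identity. *)
Ltac vring := apply: eq_vcoord => ?; rewrite !vcoordE; ring.

Ltac lie_expand := rewrite ?(linearDl, linearDr, linearNl, linearNr,
  linearZl_LR, linearZr_LR, linear0l, linear0r) /=.

Section LieBasics.
Variables (F : fieldType) (g : lieAlgebra F).
Implicit Types x y z : g.

Lemma lieC x y : [< y, x >] = - [< x, y >].
Proof.
have := lie_alt (x + y); rewrite linearDl !linearDr !lie_alt add0r addr0.
by move/eqP; rewrite addrC addr_eq0 => /eqP.
Qed.

Lemma lie_lie x y z : [< [< x, y >], z >] = [< x, [< y, z >] >] -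
  [< y, [< x, z >] >].
Proof.
have /eqP := lie_jacobi x y z; rewrite (lieC x z) (lieC [< x, y >]) linearNr.
by rewrite subr_eq0 => /eqP.
Qed.

End LieBasics.

(** * General facts on Novikov structures *)

Section NovikovGeneral.
Variables (F : fieldType) (g : lieAlgebra F).
Implicit Types v w x y z : g.

(** Left-symmetry expresses (xy - yx)w through x(yw) and y(xw); right
    commutativity lets one write the remaining terms (xy)w, (yx)w as (xw)y, (yw)x,
    so that both sides become brackets with the right multiplication by w. *)
Lemma novikov_half_derivation (mul : {bilinear g -> g -> g}) :
  is_novikov_structure mul -> forall w x y,
  mul [< x, y >] w + mul [< x, y >] w = [< mul x w, y >] + [< x, mul y w >].
Proof.
move=> [lsym rcomm brE] w x y.
have := lsym x y w; rewrite !brE linearBl /= (rcomm x y w) (rcomm y x w) => h.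
by apply: (eq_of_multiple (k := -1) h); vring.
Qed.

(** In the rest of this section, f1 and f2 are the coordinates along x1, x2
    modulo the abelian ideal [g, g]. *)
Variables (f1 f2 : {scalar g}) (x1 x2 z : g).
Hypothesis decomp : forall v, v - f1 v *: x1 - f2 v *: x2 \in lcs g 2.
Hypothesis f_derived : forall v, v \in lcs g 2 -> f1 v = 0 /\ f2 v = 0.
Hypothesis metabelian : {in lcs g 2 &, forall v w, [< v, w >] = 0}.
Hypothesis lie_z : z \in lcs g 2 /\ [< x1, z >] = [< x2, [< x1, x2 >] >].

(** When x1, x2 are independent modulo [g, g], this sends x1 to 0 and x2 to z and
    is ad x2 on [g, g]. *)
Definition metabelian_left w := [< x2, w >] + f1 w *: [< x1, x2 >] + f2 w *: z.
Definition metabelian_mul v w :=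
  f1 v *: [< x1, w >] + f2 v *: metabelian_left w.

Lemma lie_derived v w : [< v, w >] \in lcs g 2.
Proof. by apply: memv_lie; exact: memvf. Qed.

Lemma scalar_comb (f : {scalar g}) r s u v :
  f (r *: u + s *: v) = r * f u + s * f v.
Proof. by rewrite linearD !linearZ. Qed.

Lemma scalar_combl (f : {scalar g}) r u v : f (r *: u + v) = r * f u + f v.
Proof. by rewrite linearD linearZ. Qed.

Fact metabelian_mul_bilinear : bilinear_for (GRing.Scale.Law.clone _ _ *:%R _)
               (GRing.Scale.Law.clone _ _ *:%R _) metabelian_mul.
Proof.
split=> w k u v; rewrite /= /metabelian_mul /metabelian_left ?scalar_combl;
  lie_expand; vring.
Qed.

HB.instance Definition _ :=
  bilinear_isBilinear.Build F g g g _ _ metabelian_mul metabelian_mul_bilinear.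

Lemma metabelian_mul_derived v w : metabelian_mul v w \in lcs g 2.
Proof.
by case: lie_z => z2 _; rewrite !(memvD, memvZ) // lie_derived.
Qed.

Lemma metabelian_mulE v w :
  metabelian_mul v w = f1 v *: [< x1, w >] + f2 v *: metabelian_left w.
Proof. by []. Qed.

Lemma metabelian_mul_mul v w u : metabelian_mul (metabelian_mul v w) u = 0.
Proof. by have [h1 h2] := f_derived (metabelian_mul_derived v w);
  rewrite metabelian_mulE h1 h2; vring. Qed.

(** On [g, g] the operators ad x1, ad x2 commute because [[x1, x2], w] = 0;
    at x2 this is the choice of z. *)
Lemma metabelian_left_comm w :
  metabelian_left [< x1, w >] = [< x1, metabelian_left w >].
Proof.
case: (f_derived (lie_derived x1 w)) => f1w f2w; case: lie_z => z2 x1z.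
have := metabelian (lie_derived x1 x2) (decomp w).
rewrite {1}/metabelian_left f1w f2w /metabelian_left !lie_lie; lie_expand.
rewrite x1z (lieC x1 x2) !lie_alt; lie_expand => h.
by apply: (eq_of_multiple (k := -1) h); vring.
Qed.

(** All products lie in [g, g], which acts by zero on the left. So (vw)u = 0,
    and left-symmetry says that left multiplications commute; these are linear
    combinations of ad x1 and [metabelian_left]. *)
Lemma metabelian_novikov : admits_novikov_structure g.
Proof.
exists metabelian_mul; split=> [v w u|v w u|v w].
- rewrite /= !metabelian_mul_mul !subr0.
  have left_mul v' w' : metabelian_left (metabelian_mul v' w') = f1 v' *:
    metabelian_left [< x1, w' >] + f2 v' *: metabelian_left
      (metabelian_left w').
    by rewrite metabelian_mulE /metabelian_left !scalar_comb; lie_expand; vring.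
  rewrite !(metabelian_mulE _ (metabelian_mul _ _)) !left_mul !metabelian_mulE;
    lie_expand.
  by rewrite !metabelian_left_comm /metabelian_left; lie_expand; vring.
- by rewrite /= !metabelian_mul_mul.
- have := metabelian (decomp v) (decomp w);
  rewrite /= !metabelian_mulE /metabelian_left.
  lie_expand; rewrite !lie_alt (lieC x1 x2) (lieC x1 v) (lieC x2 v).
  lie_expand => h; apply: (eq_of_multiple (k := 1) h); vring.
Qed.
End NovikovGeneral.

(** * Lie algebras and products in coordinates *)

Section Coordinates.
Variables (F : numFieldType) (g : lieAlgebra F) (n : nat) (x : nat -> g).

(** Coordinate vectors are functions on nat of which only the values at 1, ..., n
    count, so that the numbering of the x_i is the usual one and formulas in
    coordinates compute. *)
Definition comb (u : nat -> F) : g := \sum_(1 <= k < n.+1) u k *: x k.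
Definition basis_tuple : n.-tuple g := [tuple x i.+1 | i < n].
Definition is_basis := basis_of {:g} basis_tuple.
Definition coords (v : g) (k : nat) : F :=
  if insub k.-1 is Some i then coord basis_tuple i v else 0.

Definition unitc (i k : nat) : F := (k == i)%:R.

(** Bilinearity of p, stated so that it includes the fact that the first n
    coordinates of the result depend only on the first n coordinates of the
    arguments: take c = 0. *)
Definition bilinear_coords (p : (nat -> F) -> (nat -> F) -> nat -> F) :=
  forall k, (0 < k <= n)%N ->
  (forall c u u' u'' v, (forall i, (0 < i <= n)%N -> u'' i = c * u i + u' i) ->
     p u'' v k = c * p u v k + p u' v k) /\
  (forall c u u' u'' v, (forall i, (0 < i <= n)%N -> u'' i = c * u i + u' i) ->
     p v u'' k = c * p v u k + p v u' k).

Lemma eq_comb (u v : nat -> F) : (forall k, (0 < k <= n)%N -> u k = v k) ->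
  comb u = comb v.
Proof. by move=> uv; apply: eq_big_nat => k lk; rewrite uv. Qed.

Lemma combP c (u v : nat -> F) :
  comb (fun k => c * u k + v k) = c *: comb u + comb v.
Proof.
rewrite /comb scaler_sumr -big_split /=; apply: eq_bigr => k _.
by rewrite scalerDl scalerA.
Qed.

Lemma combB (u v : nat -> F) : comb (fun k => u k - v k) = comb u - comb v.
Proof.
rewrite /comb -sumrB; apply: eq_bigr => k _; exact: scalerBl.
Qed.

Lemma coordsP c v w k : coords (c *: v + w) k = c * coords v k + coords w k.
Proof.
rewrite /coords; case: insub => [i|]; last by rewrite mulr0 addr0.
by rewrite linearD linearZ.
Qed.

Lemma coordsD v w k : coords (v + w) k = coords v k + coords w k.
Proof. by have := coordsP 1 v w k; rewrite scale1r mul1r. Qed.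

Lemma coordsZ c v k : coords (c *: v) k = c * coords v k.
Proof. by rewrite /coords; case: insub => [i|]; rewrite ?linearZ ?mulr0. Qed.

Lemma coords_sum I r (P : pred I) (w : I -> g) k :
  coords (\sum_(i <- r | P i) w i) k = \sum_(i <- r | P i) coords (w i) k.
Proof.
rewrite /coords; case: insub => [j|]; first exact: linear_sum.
by rewrite big1_eq.
Qed.

Lemma basis_tuple_nth i : (i < n)%N -> basis_tuple`_i = x i.+1.
Proof.
by move=> lti; rewrite (nth_mktuple _ _ (Ordinal lti)).
Qed.

Hypothesis bx : is_basis.

Lemma combK v : comb (coords v) = v.
Proof.
rewrite [RHS](coord_basis bx (memvf v)) /comb big_add1 big_mkord.
apply: eq_bigr => i _; rewrite basis_tuple_nth //.
by rewrite /coords /= insubT //= => lti; congr (coord _ _ _ *: _);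
  apply: val_inj.
Qed.

Lemma coords_comb (u : nat -> F) k : (0 < k <= n)%N -> coords (comb u) k = u k.
Proof.
case: k => // k ltk; rewrite /coords /= insubT /comb big_add1 big_mkord.
rewrite (eq_bigr (fun i : 'I_n => u i.+1 *: basis_tuple`_i)) => [|i _].
  by rewrite coord_sum_free ?(basis_free bx).
by rewrite basis_tuple_nth.
Qed.

Lemma coords_basis i k : (0 < i <= n)%N -> (0 < k <= n)%N ->
  coords (x i) k = unitc i k.
Proof.
case: i => // i lti; case: k => // k ltk.
rewrite /coords /= insubT -basis_tuple_nth //.
have := coord_free (Ordinal lti) (Ordinal ltk) (basis_free bx).
by rewrite /unitc eqSS eq_sym => <-; congr (coord _ _ _); apply: val_inj.
Qed.

Section Product.
Variable p : (nat -> F) -> (nat -> F) -> nat -> F.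
Hypothesis pP : bilinear_coords p.

Lemma eq_bilinear_coords (u u' v v' : nat -> F) k : (0 < k <= n)%N ->
  (forall i, (0 < i <= n)%N -> u i = u' i) ->
  (forall i, (0 < i <= n)%N -> v i = v' i) -> p u v k = p u' v' k.
Proof.
move=> lk uu' vv'; have [pl pr] := pP lk.
rewrite (pl 0 u u' u) => [|i /uu' ->]; last by rewrite mul0r add0r.
rewrite mul0r add0r (pr 0 v v' v) => [|i /vv' ->]; last by rewrite mul0r add0r.
by rewrite mul0r add0r.
Qed.

(** The two proofs are arguments so that the bilinear structure can be attached
    to this function. *)
Definition coord_mul (_ : is_basis) (_ : bilinear_coords p) (v w : g) :=
  comb (p (coords v) (coords w)).
Local Notation mul := (coord_mul bx pP).

Fact coord_mul_bilinear : bilinear_for (GRing.Scale.Law.clone _ _ *:%R _)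
               (GRing.Scale.Law.clone _ _ *:%R _) mul.
Proof.
split=> w c u v; rewrite /= /coord_mul -combP; apply: eq_comb => k lk;
  have [pl pr] := pP lk; [apply: pl | apply: pr] => i _; exact: coordsP.
Qed.

HB.instance Definition _ :=
  bilinear_isBilinear.Build F g g g _ _ mul coord_mul_bilinear.

(** Both sides are alternating, so the basis vectors in increasing order suffice. *)
Lemma lie_eq_coord_mul :
  (forall u v k, p v u k = - p u v k) ->
  (forall i j, (0 < i)%N -> (i < j <= n)%N ->
     [< x i, x j >] = comb (p (unitc i) (unitc j))) ->
  forall v w, [< v, w >] = mul v w.
Proof.
move=> pC lie_x.
have mulC v w : mul w v = - mul v w.
  apply/eqP; rewrite -addr_eq0; apply/eqP.
  rewrite -[X in X + _]scale1r -combP /comb big1 // => k _.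
  by rewrite mul1r pC addNr scale0r.
have mul_x i j : (0 < i <= n)%N -> (0 < j <= n)%N ->
    mul (x i) (x j) = comb (p (unitc i) (unitc j)).
  move=> li lj; apply: eq_comb => k lk.
  by apply: eq_bilinear_coords => // l ll; rewrite coords_basis.
have lie_x2 i j : (0 < i <= n)%N -> (0 < j <= n)%N ->
  [< x i, x j >] = mul (x i) (x j).
  move=> li lj; have /andP[i0 lein] := li; have /andP[j0 lejn] := lj.
  have [ltij|ltji|->] := ltngtP i j.
  - by rewrite mul_x // lie_x ?ltij.
  - by rewrite lieC mulC mul_x // lie_x ?ltji.
  - rewrite lie_alt; have /eqP := mulC (x j) (x j).
    rewrite -addr_eq0 -mulr2n -scaler_nat scaler_eq0 pnatr_eq0 /=.
    by move/eqP.
move=> v w; rewrite -(combK v) -(combK w) /comb !linear_sumlz /=.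
apply: eq_big_nat => i li; rewrite !linearZl_LR !linear_sumr /=; congr (_ *: _).
by apply: eq_big_nat => j lj; rewrite !linearZr_LR /= lie_x2.
Qed.

Lemma coords_mul v w k : (0 < k <= n)%N ->
  coords (mul v w) k = p (coords v) (coords w) k.
Proof. exact: coords_comb. Qed.

Lemma novikov_of_coords :
  (forall v w, [< v, w >] = comb
    (fun k => p (coords v) (coords w) k - p (coords w) (coords v) k)) ->
  (forall u v w k, (0 < k <= n)%N ->
     p u (p v w) k - p (p u v) w k = p v (p u w) k - p (p v u) w k) ->
  (forall u v w k, (0 < k <= n)%N -> p (p u v) w k = p (p u w) v k) ->
  admits_novikov_structure g.
Proof.
move=> brE lsym rcomm; exists mul.
have mulmul_r u v w : mul u (mul v w) = comb
  (p (coords u) (p (coords v) (coords w))).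
  apply: eq_comb => k lk; apply: eq_bilinear_coords => // i li.
  exact: coords_mul.
have mulmul_l u v w : mul (mul u v) w = comb
  (p (p (coords u) (coords v)) (coords w)).
  apply: eq_comb => k lk; apply: eq_bilinear_coords => // i li.
  exact: coords_mul.
split=> [u v w|u v w|u v] /=.
- by rewrite !mulmul_r !mulmul_l -!combB; apply: eq_comb => k lk; exact: lsym.
- by rewrite !mulmul_l; apply: eq_comb => k lk; exact: rcomm.
- by rewrite brE combB.
Qed.

End Product.
End Coordinates.

(** * Brackets and Novikov products in dimensions 6 and 7 *)

Section Tables.
Variable F : numFieldType.
Implicit Types (a b c d : F) (u v : nat -> F).

Definition bracket7 a b c d u v (k : nat) : F :=
  let m i j := u i * v j - u j * v i in
  match k with
  | 3%N => m 1%N 2%N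
  | 4%N => m 1%N 3%N
  | 5%N => m 1%N 4%N + a * m 2%N 3%N
  | 6%N => m 1%N 5%N + b * m 2%N 3%N + a * m 2%N 4%N
  | 7%N => m 1%N 6%N + c * m 2%N 3%N + b * m 2%N 4%N + d * m 2%N 5%N + (a - d) *
    m 3%N 4%N
  | _ => 0
  end.

Definition bracket6 a b c u v (k : nat) : F :=
  let m i j := u i * v j - u j * v i in
  match k with
  | 3%N => m 1%N 2%N
  | 4%N => m 1%N 3%N
  | 5%N => m 1%N 4%N + a * m 2%N 3%N
  | 6%N => m 1%N 5%N + b * m 2%N 3%N + a * m 2%N 4%N + c *
    (m 2%N 5%N - m 3%N 4%N)
  | _ => 0
  end.

(** Here x_2 x_2 = - (a / 3) x_4 + b x_5. The coefficient - a / 3 is the one for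
    which the right multiplication by x_2, sending x_1 to x_3, can be a half
    derivation when c <> 0. That property gives the products x_i x_2, and the
    others follow from x_(i+1) y = x_1 (x_i y) - x_i (x_1 y). *)
Definition product6 a b c u v (k : nat) : F :=
  match k with
  | 3%N => u 1%N * v 2%N
  | 4%N => u 1%N * v 3%N - a / 3%:R * (u 2%N * v 2%N)
  | 5%N => u 1%N * v 4%N + b * (u 2%N * v 2%N)
         + a / 3%:R * (u 2%N * v 3%N - (u 3%N * v 2%N) *+ 2)
  | 6%N => u 1%N * v 5%N + b * (u 2%N * v 3%N)
         + a / 3%:R * ((u 2%N * v 4%N) *+ 2 - u 3%N * v 3%N - u 4%N * v 2%N)
         + c / 2%:R * (u 2%N * v 5%N - u 3%N * v 4%N + u 4%N * v 3%N
                      - u 5%N * v 2%N)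
  | _ => 0
  end.

(** With D = ad x_1, the product of u and v in the span of x_2, ..., x_7 is
    u_2 (b D^3 + c D^4) v plus half of the part of [u, v] that involves d. *)
Definition product7 b c d u v (k : nat) : F :=
  match k with
  | 3%N => u 1%N * v 2%N
  | 4%N => u 1%N * v 3%N
  | 5%N => u 1%N * v 4%N + b * (u 2%N * v 2%N)
  | 6%N => u 1%N * v 5%N + b * (u 2%N * v 3%N) + c * (u 2%N * v 2%N)
  | 7%N => u 1%N * v 6%N + b * (u 2%N * v 4%N) + c * (u 2%N * v 3%N)
         + d / 2%:R * (u 2%N * v 5%N - u 3%N * v 4%N + u 4%N * v 3%N
                      - u 5%N * v 2%N)
  | _ => 0
  end.

(** The coefficient 3 of x_4 in x_2 x_2 is the value to which the equations in
    the proof of [novikov_parameter] lead; the other products are determined by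
    it as in [product6]. *)
Definition product7_tenth u v (k : nat) : F :=
  match k with
  | 3%N => u 1%N * v 2%N
  | 4%N => u 1%N * v 3%N + 3%:R * (u 2%N * v 2%N)
  | 5%N => u 1%N * v 4%N + 2%:R * (u 2%N * v 3%N) + u 3%N * v 2%N
  | 6%N => u 1%N * v 5%N + 3%:R / 2%:R * (u 2%N * v 4%N)
         + 1 / 2%:R * (u 3%N * v 3%N + u 4%N * v 2%N)
  | 7%N => u 1%N * v 6%N + 6%:R / 5%:R * (u 2%N * v 5%N)
         + 3%:R / 10%:R * (u 3%N * v 4%N + u 5%N * v 2%N)
         + 1 / 5%:R * (u 4%N * v 3%N)
  | _ => 0
  end.

Lemma bracket7_bilinear a b c d : bilinear_coords 7 (bracket7 a b c d).
Proof.
move=> k lk; split=> r u u' u'' v uE.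
all: move: k lk; case=> [|[|[|[|[|[|[|[|k]]]]]]]] //= _; rewrite ?uE //; ring.
Qed.

Lemma bracket6_bilinear a b c : bilinear_coords 6 (bracket6 a b c).
Proof.
move=> k lk; split=> r u u' u'' v uE.
all: move: k lk; case=> [|[|[|[|[|[|[|k]]]]]]] //= _; rewrite ?uE //; ring.
Qed.

Lemma product6_bilinear a b c : bilinear_coords 6 (product6 a b c).
Proof.
move=> k lk; split=> r u u' u'' v uE.
all: move: k lk; case=> [|[|[|[|[|[|[|k]]]]]]] //= _; rewrite ?uE //; ring.
Qed.

Lemma product7_bilinear b c d : bilinear_coords 7 (product7 b c d).
Proof.
move=> k lk; split=> r u u' u'' v uE.
all: move: k lk; case=> [|[|[|[|[|[|[|[|k]]]]]]]] //= _; rewrite ?uE //; ring.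
Qed.

Lemma product7_tenth_bilinear : bilinear_coords 7 product7_tenth.
Proof.
move=> k lk; split=> r u u' u'' v uE.
all: move: k lk; case=> [|[|[|[|[|[|[|[|k]]]]]]]] //= _; rewrite ?uE //; ring.
Qed.

Variables (g : lieAlgebra F) (x : nat -> g).

Definition has_bracket n (br : (nat -> F) -> (nat -> F) -> nat -> F) :=
  is_basis n x /\ forall v w :
    g, [< v, w >] = comb n x (br (coords n x v) (coords n x w)).

Lemma novikov6 a b c : has_bracket 6 (bracket6 a b c) ->
  admits_novikov_structure g.
Proof.
case=> bx brE; apply: (novikov_of_coords bx (@product6_bilinear a b c)).
- move=> v w; rewrite brE; apply: eq_comb => k.
  move: (coords _ _ v) (coords _ _ w) => s t.
  case: k => [|[|[|[|[|[|[|k]]]]]]] //= _; rewrite /bracket6 /product6;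
    by field.
- move=> u v w k; case: k => [|[|[|[|[|[|[|k]]]]]]] //= _; by field.
- move=> u v w k; case: k => [|[|[|[|[|[|[|k]]]]]]] //= _; by field.
Qed.

Lemma novikov7 b c d : has_bracket 7 (bracket7 0 b c d) ->
  admits_novikov_structure g.
Proof.
case=> bx brE; apply: (novikov_of_coords bx (@product7_bilinear b c d)).
- move=> v w; rewrite brE; apply: eq_comb => k.
  move: (coords _ _ v) (coords _ _ w) => s t.
  case: k => [|[|[|[|[|[|[|[|k]]]]]]]] //= _; rewrite /bracket7 /product7;
    by field.
- move=> u v w k; case: k => [|[|[|[|[|[|[|[|k]]]]]]]] //= _; by field.
- move=> u v w k; case: k => [|[|[|[|[|[|[|[|k]]]]]]]] //= _; by field.
Qed.

Lemma novikov7_tenth :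
  has_bracket 7 (bracket7 1 0 0 (1 - 1 / 10%:R)) -> admits_novikov_structure g.
Proof.
case=> bx brE; apply: (novikov_of_coords bx product7_tenth_bilinear).
- move=> v w; rewrite brE; apply: eq_comb => k.
  move: (coords _ _ v) (coords _ _ w) => s t.
  case: k => [|[|[|[|[|[|[|[|k]]]]]]]] //= _; rewrite /bracket7 /product7;
    by field.
- move=> u v w k; case: k => [|[|[|[|[|[|[|[|k]]]]]]]] //= _; by field.
- move=> u v w k; case: k => [|[|[|[|[|[|[|[|k]]]]]]]] //= _; by field.
Qed.

End Tables.

(** * Adapted bases of filiform Lie algebras *)

(** Each j marks at most one element of ts, so not all of ts can be marked. *)
Lemma exists_unmarked (J T : eqType) (s : seq J) (bad : J -> pred T)
    (ts : seq T) :
  uniq ts -> (size s < size ts)%N ->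
  (forall j t t', j \in s -> bad j t -> bad j t' -> t = t') ->
  exists2 t, t \in ts & forall j, j \in s -> ~~ bad j t.
Proof.
elim: s ts => [|j s IHs] ts uts lts bad1.
  by case: ts lts {uts} => // t ts _; exists t; rewrite ?mem_head.
have count1 : (count (bad j) ts <= 1)%N.
  rewrite -size_filter; have := filter_uniq (bad j) uts.
  case Dr: filter => [|t [|t' r]] //= /andP[]; rewrite inE negb_or.
  suff -> : t = t' by rewrite eqxx.
  have := mem_head t (t' :: r);
    have : t' \in [:: t, t' & r] by rewrite !inE eqxx orbT.
  rewrite -Dr !mem_filter => /andP[bt' _] /andP[bt _].
  by apply: bad1 bt bt'; exact: mem_head.
have [||k t t' ks|t] := IHs (filter (predC (bad j)) ts).
- exact: filter_uniq.
- rewrite size_filter -(leq_add2l (count (bad j) ts)) count_predC.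
  by apply: leq_trans lts; rewrite /= -(addn1 (size s).+1) addnC leq_add2l.
- by apply: bad1; rewrite inE ks orbT.
rewrite mem_filter => /andP[/= njt tts] tP; exists t => // k.
by rewrite inE => /predU1P[->|/tP].
Qed.

(** A vector space over an infinite field is not a finite union of proper
    subspaces: if x avoids all P k with k in s but not P j, and y avoids P j, then
    the line y + t x never meets P j and meets each other P k at most once. *)
Lemma avoid_subspaces (F : numFieldType) (V : lmodType F) (J : eqType)
    (s : seq J) (P : J -> pred V) :
  (forall j c u v, P j u -> P j v -> P j (c *: u + v)) ->
  (forall j, j \in s -> exists v, ~~ P j v) ->
  exists v, forall j, j \in s -> ~~ P j v.
Proof.
move=> Plin; elim: s => [|j s IHs] Pproper; first by exists 0.
have [k ks|x xP] := IHs; first by apply: Pproper; rewrite inE ks orbT.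
have [y yj] := Pproper j (mem_head j s).
have [Pjx|] := boolP (P j x); last first.
  by move=> xj; exists x => k; rewrite inE => /predU1P[->|/xP].
have [||k t t' ks Pt Pt'|t _ tP] :=
    @exists_unmarked J nat s (fun k t => P k (y + t%:R *: x))
      (iota 0 (size s).+1).
- exact: iota_uniq.
- by rewrite size_iota.
- apply/eqP/contraT => ntt'; have /negP[] := xP k ks.
  have ntt'F : (t%:R - t'%:R : F) != 0 by rewrite subr_eq0 eqr_nat.
  have P0 : P k 0 by rewrite -[0](addNr (y + t%:R *: x)) -scaleN1r Plin.
  suff -> : x = (t%:R - t'%:R : F)^-1 *:
    ((-1) *: (y + t'%:R *: x) + (y + t%:R *: x)) + 0.
    by rewrite !Plin.
  rewrite scaleN1r addr0 opprD addrACA addNr add0r addrC -scalerBl scalerA.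
  by rewrite mulVf // scale1r.
exists (y + t%:R *: x) => k; rewrite inE => /predU1P[->|/tP //].
apply: contra yj => Pjy.
suff -> : y = (- t%:R) *: x + (y + t%:R *: x) by rewrite Plin.
by rewrite addrCA -scalerDl addNr scale0r addr0.
Qed.

Lemma dim_add_line (F : fieldType) (V : vectType F) (U : {vspace V}) v :
  v \notin U -> \dim (<[v]> + U) = (\dim U).+1.
Proof.
move=> vU; apply/eqP; rewrite eqn_leq; apply/andP; split.
  have [/leq_trans -> //] := dimv_add_leqif <[v]> U.
  by rewrite dim_vline -add1n leq_add2r; case: eqP.
have [le_dim] := dimv_leqif_sup (addvSr <[v]> U).
rewrite ltn_neqAle le_dim andbT => ->.
by apply: contra vU => /subvP; apply; apply: (subvP (addvSl _ _));
  exact: memv_line.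
Qed.

Lemma add_line_of_dim (F : fieldType) (V : vectType F) (U W : {vspace V}) v :
  (U <= W)%VS -> v \in W -> v \notin U -> \dim W = (\dim U).+1 ->
  (<[v]> + U)%VS = W.
Proof.
move=> sUW vW vU dimW; apply/eqP;
  rewrite eqEdim dim_add_line // dimW leqnn andbT.
by rewrite subv_add sUW andbT -memvE.
Qed.

Section Ladder.
Variables (F : numFieldType) (g : lieAlgebra F).
Implicit Types (x y v w : g) (i j k : nat).

(** The sequence x_1, x_2, x_(k+1) = [x_1, x_k]; the value at k = 0 is junk. *)
Definition ladder x1 x2 k : g :=
  if k is k'.+2 then iter k' (fun w => [< x1, w >]) x2 else x1.

Definition adapted x1 x2 :=
  [/\ fullv = (<[x1]> + (<[x2]> + lcs g 2))%VS,
      forall i, (1 < i)%N -> (lcs g i <= <[ladder x1 x2 i.+1]> + lcs g i.+1)%VS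
    & [< x2, [< x1, x2 >] >] \in lcs g 4].

Lemma lcsSS i : lcs g i.+2 = lieprod fullv (lcs g i.+1).
Proof. by []. Qed.

Lemma memv_lcs i v w : (0 < i)%N -> w \in lcs g i -> [< v, w >] \in lcs g i.+1.
Proof. by case: i => // i _; apply: memv_lie; exact: memvf. Qed.

Lemma memv_lcs_l i v w : (0 < i)%N -> w \in lcs g i ->
  [< w, v >] \in lcs g i.+1.
Proof. by move=> i0 wi; rewrite lieC memvN memv_lcs. Qed.

Lemma lcsS i : (lcs g i.+1 <= lcs g i)%VS.
Proof.
elim: i => [|[|i] IHi]; rewrite ?subvf //.
by apply/lieprodP => v w _ wi; apply: memv_lcs => //; exact: (subvP IHi).
Qed.

Lemma lcs_le i j : (i <= j)%N -> (lcs g j <= lcs g i)%VS.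
Proof.
move/subnK <-; elim: (j - i)%N => [|k IHk]; first exact: subvv.
exact: subv_trans (lcsS _) IHk.
Qed.

Lemma ladderSS x1 x2 k : ladder x1 x2 k.+3 = [< x1, ladder x1 x2 k.+2 >].
Proof. by []. Qed.

Lemma ladder_lcs x1 x2 k : ladder x1 x2 k.+2 \in lcs g k.+1.
Proof. by elim: k => [|k IHk]; [exact: memvf | exact: memv_lcs]. Qed.

Section Filiform.
Variable p : nat.
Hypotheses (p_gt0 : (0 < p)%N) (dimg : \dim {:g} = p.+1).
Hypothesis class_p : nilpotency_class g p.

Lemma lcs_eq0 i : (p < i)%N -> lcs g i = 0%VS.
Proof.
have [gp0 _] := class_p.
by move=> ltpi; apply/eqP; rewrite -subv0 -[X in (_ <= X)%VS]gp0 lcs_le.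
Qed.

Lemma lcs_proper i : (0 < i <= p)%N -> (\dim (lcs g i.+1) < \dim (lcs g i))%N.
Proof.
case/andP=> i_gt0 leip; rewrite ltn_neqAle (dimvS (lcsS i)) andbT.
apply/negP => /eqP eqdim.
have eqi : lcs g i.+1 = lcs g i by apply/eqP; rewrite eqEdim lcsS eqdim leqnn.
have eqj k : lcs g (i + k) = lcs g i.
  elim: k => [|k IHk]; first by rewrite addn0.
  case: i i_gt0 {leip eqdim} eqi IHk => // i _ eqi IHk.
  by rewrite addnS addSn lcsSS -addSn IHk -lcsSS.
have [_ minp] := class_p; have ltip : (i.-1 < p)%N by rewrite prednK.
apply: (minp _ ltip); rewrite /step_nilpotent prednK // -(eqj (p.+1 - i)%N).
by rewrite subnKC ?lcs_eq0 // leqW.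
Qed.

Lemma lie_add_multiples i x a b v w : (0 < i)%N -> v \in lcs g i ->
  w \in lcs g i ->
  [< a *: x + v, b *: x + w >] \in lcs g i.+1.
Proof.
move=> i_gt0 vi wi; rewrite !linearDl !linearDr !linearZl_LR !linearZr_LR /=.
by rewrite lie_alt !scaler0 add0r !rpredD ?memvZ ?(memv_lcs _ i_gt0 wi)
  ?(memv_lcs_l _ i_gt0 vi).
Qed.

(** If [g, g] had codimension 1, g would be spanned by some v and [g, g], and all
    brackets would lie in g^3. *)
Lemma dim_lcs2 : (\dim (lcs g 2) < p)%N.
Proof.
have [le1p|gt1p] := leqP p 1.
  have p1 : p = 1%N by apply/eqP; rewrite eqn_leq le1p.
  by rewrite lcs_eq0 ?dimv0 p1.
rewrite ltnNge; apply/negP => lep.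
have dim2 : \dim (lcs g 2) = p.
  apply/eqP; rewrite eqn_leq lep andbT -ltnS -dimg.
  by apply: (@lcs_proper 1); rewrite p_gt0.
have [v _ vN] : exists2 v, v \in {:g}%VS & v \notin lcs g 2.
  by apply/subvPn/negP => /dimvS; rewrite dim2 dimg ltnn.
have full_v : (<[v]> + lcs g 2)%VS = fullv.
  by apply: add_line_of_dim; rewrite ?subvf ?memvf ?dimg ?dim2.
suff: (lcs g 2 <= lcs g 3)%VS.
  by move/dimvS; rewrite leqNgt lcs_proper.
apply/lieprodP => x y _ _.
have /memv_addP[_ /vlineP[a ->] [x' x2 ->]] : x \in (<[v]> + lcs g 2)%VS.
  by rewrite full_v memvf.
have /memv_addP[_ /vlineP[b ->] [y' y2 ->]] : y \in (<[v]> + lcs g 2)%VS.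
  by rewrite full_v memvf.
exact: lie_add_multiples.
Qed.

(** The dimension drops at least by 2 from g to g^2 and at least by 1 at each of
    the p - 1 further steps; the total p + 1 leaves no room for more. *)
Lemma dim_lcs i : (1 < i <= p.+1)%N -> \dim (lcs g i) = (p.+1 - i)%N.
Proof.
case/andP=> lt1i leip; apply/eqP; rewrite eqn_leq; apply/andP; split.
  have lt2 := dim_lcs2; rewrite -(subnKC lt1i) in leip *.
  elim: (i - 2)%N leip => [|k IHk] lekp; first by rewrite leq_subRL.
  rewrite addnS subnS -ltnS prednK ?subn_gt0 //.
  by apply: leq_trans (IHk (ltnW lekp)); rewrite lcs_proper.
have {lt1i} : (0 < i)%N := ltnW lt1i.
rewrite -(subKn leip); elim: (p.+1 - i)%N (leq_subr i p.+1) => [|k IHk] lek i0.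
  by rewrite subn0 subnn.
rewrite subKn //; rewrite subn_gt0 in i0.
have := IHk (ltnW lek); rewrite subn_gt0 subKn ?(ltnW lek) //.
move=> /(_ (ltnW i0)) h; apply: leq_ltn_trans h _.
rewrite -subnSK // lcs_proper //; lia.
Qed.

Lemma lcs_line i v : (1 < i)%N -> v \in lcs g i -> v \notin lcs g i.+1 ->
  (lcs g i <= <[v]> + lcs g i.+1)%VS.
Proof.
move=> lt1i vi viS; suff <- : (<[v]> + lcs g i.+1)%VS = lcs g i by exact: subvv.
have leip : (i <= p)%N.
  by rewrite leqNgt; apply: contra viS => /lcs_eq0 i0; move: vi;
    rewrite i0 memv0 => /eqP->; exact: mem0v.
have iP : (1 < i <= p.+1)%N by rewrite lt1i leqW.
have iSP : (1 < i.+1 <= p.+1)%N by rewrite ltnS ltnW.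
apply: add_line_of_dim; rewrite ?lcsS // (dim_lcs iP) (dim_lcs iSP).
by rewrite subnSK // subSn.
Qed.

Lemma lcs2_line x y : fullv = (<[x]> + (<[y]> + lcs g 2))%VS ->
  (lcs g 2 <= <[ [< x, y >] ]> + lcs g 3)%VS.
Proof.
move=> full_xy; apply/lieprodP => v w _ _.
have dec u : exists c : F * F, exists2 u', u' \in lcs g 2 &
  u = c.1 *: x + c.2 *: y + u'.
  have : u \in {:g}%VS by exact: memvf.
  rewrite full_xy => /memv_addP[_ /vlineP[a ->]
    [_ /memv_addP[_ /vlineP[b ->] [u' u2 ->]] ->]].
  by exists (a, b), u' => //; rewrite addrA.
have [[a b] [v' v2 ->]] := dec v; have [[c d] [w' w2 ->]] := dec w.
rewrite /= [X in X \in _](_ : _ = (a * d - b * c) *: [< x, y >] +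
   ([< a *: x + b *: y, w' >] + [< v', c *: x + d *: y + w' >])).
  rewrite memv_add ?memvZ ?memv_line // rpredD //.
    exact: (@memv_lcs 2).
  exact: (@memv_lcs_l 2).
lie_expand; rewrite !lie_alt (lieC x y); vring.
Qed.

(** Take x_1 outside g^2 and outside all the subspaces of the y with
    [y, g^i] in g^(i+2), so that ad x_1 maps each line g^i / g^(i+1), i >= 2, onto
    the next one. Any y independent of x_1 modulo g^2 completes x_1, and
    subtracting a multiple of x_1 from y makes it centralize g^2 modulo g^4. *)
Lemma filiform_adapted : exists x1 x2, adapted x1 x2.
Proof.
(* The index 1 stands for g^2 itself, an index i > 1 for the vectors that map g^i
   into g^(i+2). *)
pose P i := [pred y | if i == 1%N then y \in lcs g 2
                      else (lieprod <[y]> (lcs g i) <= lcs g i.+2)%VS].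
have lineP (i : nat) y :
  reflect (forall w, w \in lcs g i -> [< y, w >] \in lcs g i.+2)
                         (lieprod <[y]> (lcs g i) <= lcs g i.+2)%VS.
  apply: (iffP (lieprodP _ _ _)) => [yi w wi|yi _ w /vlineP[c ->] wi].
    by apply: yi wi; exact: memv_line.
  by rewrite linearZl_LR memvZ // yi.
have [||x1 x1P] := @avoid_subspaces F g nat (1%N :: iota 2 (p - 2)) P.
- move=> i c u v /=; case: eqP => _; first by move=> *; rewrite memvD ?memvZ.
  move=> /lineP ui /lineP vi; apply/lineP => w wi.
  by rewrite linearDl linearZl_LR memvD ?memvZ ?ui ?vi.
- move=> i; rewrite inE => /predU1P[->|] /=.
    have /subvPn[v _ vN] : ~~ (fullv <= lcs g 2)%VS.
      by apply/negP => /dimvS; rewrite dimg leqNgt (leq_trans dim_lcs2).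
    by exists v.
  rewrite mem_iota => /andP[lt1i ltip]; rewrite gtn_eqF //.
  have lei : (i < p)%N by lia.
  have /subvPn[v vi viN] : ~~ (lcs g i.+1 <= lcs g i.+2)%VS.
    by apply/negP => /dimvS; rewrite leqNgt lcs_proper.
  have i_gt0 := ltnW lt1i.
  have : ~~ all (fun v => v \in lcs g i.+2)
      [seq [< x, y >] | x <- vbasis {:g}, y <- vbasis (lcs g i)].
    apply: contra viN => /allP viS; move: v vi; apply/subvP.
    by rewrite -(prednK i_gt0) lcsSS prednK //; apply/span_subvP.
  case/allPn => _ /allpairsP[[y w] [/= _ /vbasis_mem wi ->]] ywN.
  by exists y; apply: contra ywN => /lineP; apply.
have x1N2 : x1 \notin lcs g 2 by apply: (x1P 1%N); rewrite mem_head.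
have dim1 : (\dim (<[x1]> + lcs g 2) < \dim {:g})%N.
  by rewrite dim_add_line // dimg ltnS dim_lcs2.
have [y _ yN] : exists2 y, y \in {:g}%VS & y \notin (<[x1]> + lcs g 2)%VS.
  by apply/subvPn/negP => /dimvS; rewrite leqNgt dim1.
have dim2 : \dim (lcs g 2) = p.-1.
  by rewrite dim_lcs //; lia.
have full_y : fullv = (<[x1]> + (<[y]> + lcs g 2))%VS.
  rewrite addvA (addvC <[x1]>%VS) -addvA; apply/esym/add_line_of_dim;
    rewrite ?subvf ?memvf // dim_add_line // dim2 prednK //.
have lad i : (1 < i)%N -> (lcs g i <= <[ladder x1 y i.+1]> + lcs g i.+1)%VS.
  case: i => [|[|i]] // _; elim: i => [|i IHi]; first exact: lcs2_line.
  have [lei|lti] := leqP p i.+2; first by rewrite (@lcs_eq0 i.+3) // sub0v.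
  apply: lcs_line => //; first exact: ladder_lcs.
  have : ~~ P i.+2 x1 by apply: x1P; rewrite inE mem_iota /=; lia.
  apply: contra => xN; rewrite
    -[P _ _]/(lieprod <[x1]> (lcs g i.+2) <= lcs g i.+4)%VS.
  apply/lineP => w /(subvP IHi).
  case/memv_addP => _ /vlineP[c ->] [w' w3 ->].
  rewrite linearDr linearZr_LR; apply: memvD; first by apply: memvZ; exact: xN.
  exact: (@memv_lcs i.+3).
have : [< y, [< x1, y >] >] \in (<[ladder x1 y 4]> + lcs g 4)%VS.
  by apply: (subvP (lad 3%N isT)); rewrite !memv_lcs ?memvf.
case/memv_addP => _ /vlineP[c ->] [u u4 yE].
exists x1, (y - c *: x1).
have x3E : [< x1, y - c *: x1 >] = [< x1, y >].
  by rewrite linearDr linearNr linearZr_LR /= lie_alt scaler0 subr0.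
have ladE i : ladder x1 (y - c *: x1) i.+3 = ladder x1 y i.+3.
  by elim: i => [//|i IHi]; rewrite ladderSS IHi.
split.
- apply/eqP; rewrite eqEsubv (subvf (_ + _)%VS) andbT full_y.
  rewrite !subv_add addvSl /=; apply/andP; split; last first.
    by apply/subvP => v v2;
      rewrite -[v]add0r memv_add ?mem0v // -[v]add0r memv_add ?mem0v.
  rewrite -memvE; suff : c *: x1 + (y - c *: x1) \in
      (<[x1]> + (<[y - c *: x1]> + lcs g 2))%VS by rewrite addrCA subrr addr0.
  rewrite memv_add ?memvZ ?memv_line //.
  by apply: (subvP (addvSl _ _)); exact: memv_line.
- by case=> [|[|i]] // lt1i; rewrite ladE lad.
- rewrite x3E linearDl linearNl linearZl_LR /= yE addrAC.
  by rewrite [ladder _ _ _]/(ladder x1 y 4) subrr add0r.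
Qed.

End Filiform.

Section Adapted.
Variables (p : nat) (x1 x2 : g).
Hypotheses (p_gt0 : (0 < p)%N) (dimg : \dim {:g} = p.+1).
Hypotheses (class_p : nilpotency_class g p) (x12 : adapted x1 x2).
Local Notation x := (ladder x1 x2).

Lemma lcs_head i v : (1 < i)%N -> v \in lcs g i ->
  exists c, exists2 w, w \in lcs g i.+1 & v = c *: x i.+1 + w.
Proof.
case: x12 => _ lad _ lt1i /(subvP (lad i lt1i)).
by case/memv_addP => _ /vlineP[c ->] [w wi ->]; exists c, w.
Qed.

Lemma ladder_basis : is_basis p.+1 x.
Proof.
case: x12 => full_x lad _.
rewrite /is_basis basisEdim size_tuple dimg leqnn andbT.
have xS i : (0 < i <= p.+1)%N -> x i \in <<basis_tuple p.+1 x>>%VS.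
  case: i => // i ltip; apply: memv_span.
  by rewrite -(basis_tuple_nth x ltip) mem_nth // size_tuple.
have lcs_span k i : (1 < i)%N -> (p < i + k)%N ->
  (lcs g i <= <<basis_tuple p.+1 x>>)%VS.
  elim: k i => [|k IHk] i lt1i; first by rewrite addn0 => /(lcs_eq0 class_p)->;
    exact: sub0v.
  rewrite addnS -addSn => ltpi; have [leip|ltpi'] := leqP i p; last first.
    by rewrite (lcs_eq0 class_p ltpi') sub0v.
  apply/subvP => v /(subvP (lad i lt1i)).
  case/memv_addP => _ /vlineP[c ->] [w wi ->]; apply: memvD.
    by apply: memvZ; exact: xS.
  by apply: (subvP (IHk i.+1 _ ltpi)) => //; exact: ltnW.
rewrite full_x !subv_add -!memvE (lcs_span p) ?ltnS ?leq_addl //.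
by rewrite (xS 1%N) ?(xS 2%N).
Qed.
End Adapted.
End Ladder.

(** * Reduction in dimension at most 7 *)

Section Classification.
Variables (F : numFieldType) (g : lieAlgebra F).
Variables (p : nat) (x1 x2 : g).
Hypotheses (p_gt0 : (0 < p)%N) (dimg : \dim {:g} = p.+1).
Hypotheses (class_p : nilpotency_class g p) (x12 : adapted x1 x2).
Local Notation x := (ladder x1 x2).

Let bx : is_basis p.+1 x := ladder_basis p_gt0 dimg class_p x12.

Lemma lcs_big i v : (p < i)%N -> v \in lcs g i -> v = 0.
Proof. by move=> lti; rewrite (lcs_eq0 class_p lti) memv0 => /eqP. Qed.

Lemma lie_ladder_big v k : (p < k)%N -> [< v, x k >] = 0.
Proof.
case: k => [|[|k]] // ltk; first by move: ltk; rewrite ltnNge p_gt0.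
by apply: (@lcs_big k.+2) => //; apply: memv_lcs => //; exact: ladder_lcs.
Qed.

Lemma coords_lcs i k v : (1 < i)%N -> v \in lcs g i -> (0 < k <= i)%N ->
  (k <= p.+1)%N ->
  coords p.+1 x v k = 0.
Proof.
move=> lt1i vi lk lekp.
have [m ltm] : exists m, (p < i + m)%N by exists p.+1; rewrite addnC leq_addr.
elim: m i v lt1i vi lk ltm => [|m IHm] i v lt1i vi lk ltm.
  rewrite addn0 in ltm; rewrite (lcs_big ltm vi) /coords.
  by case: insub => [?|] //; rewrite linear0.
have [lei|lti] := leqP i p; last first.
  rewrite (lcs_big lti vi) /coords.
  by case: insub => [?|] //; rewrite linear0.
have [c [w wi ->]] := lcs_head x12 lt1i vi.
rewrite coordsP (IHm i.+1 w) ?addSnnS ?(leqW lt1i) //;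
  last by case/andP: lk => -> /leqW.
rewrite (coords_basis bx (i := i.+1)) // /unitc; last by case/andP: lk => ->.
case/andP: lk => _ lki; by rewrite ltn_eqF ?mulr0 ?addr0.
Qed.

Lemma lie_head_onto i v : (1 < i)%N -> v \in lcs g i.+1 ->
  exists2 w, w \in lcs g i & [< x1, w >] = v.
Proof.
move=> lt1i vi.
have [m ltm] : exists m, (p < i + m)%N by exists p.+1; rewrite addnC leq_addr.
elim: m i v lt1i vi ltm => [|m IHm] i v lt1i vi ltm.
  exists 0; rewrite ?mem0v // linear0r; apply/esym/(@lcs_big i.+1) => //.
  by rewrite addn0 in ltm; exact: leqW.
have [c [w wi ->]] := lcs_head x12 (leqW lt1i) vi.
have [|u uS <-] := IHm i.+1 w (leqW lt1i) wi; first by rewrite addSnnS.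
case: i lt1i {vi wi ltm} uS => [|[|i]] // _ uS.
exists (c *: x i.+3 + u); last by rewrite linearDr linearZr_LR.
by rewrite memvD ?memvZ ?(ladder_lcs _ _ i.+1) // (subvP (lcsS _ _)).
Qed.

(** Since [x_2, x_3] lies in g^4 = [x_1, g^3], the vector z that
    [metabelian_novikov] requires exists. *)
Lemma metabelian_adapted :
  (forall i j, (2 < i < j)%N -> (j <= p)%N -> [< x i, x j >] = 0) ->
  admits_novikov_structure g.
Proof.
move=> comm.
have lt1 : (1 < p.+1)%N by [].
have fE k (ltk : (k < p.+1)%N) v :
    coord (basis_tuple p.+1 x) (Ordinal ltk) v = coords p.+1 x v k.+1.
  by rewrite /coords /= insubT.
have [z z2 x1z] : exists2 z, z \in lcs g 2 &
  [< x1, z >] = [< x2, [< x1, x2 >] >].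
  have [|z z3 <-] := @lie_head_onto 3 [< x2, [< x1, x2 >] >] isT;
    first by case: x12.
  by exists z => //; apply: (subvP (lcsS g 2)).
apply: (@metabelian_novikov F g
  (coord (basis_tuple p.+1 x) (Ordinal (isT : 0 < p.+1)%N))
  (coord (basis_tuple p.+1 x) (Ordinal lt1)) x1 x2 z) => //.
- move=> v; have : v \in {:g}%VS by exact: memvf.
  have [-> _ _] := x12; case/memv_addP =>
    _ /vlineP[a ->] [_ /memv_addP[_ /vlineP[b ->] [u u2 ->]] ->].
  rewrite /= !fE !coordsP !(coords_lcs _ u2) //
    !(coords_basis bx (i := 1%N)) //.
  rewrite !(coords_basis bx (i := 2%N)) // /unitc /=.
  rewrite [X in X \in _](_ : _ = u) //; vring.
- by move=> v v2; rewrite /= !fE !(coords_lcs _ v2).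
- have comm' i j : (2 < i <= p.+1)%N -> (2 < j <= p.+1)%N -> [< x i, x j >] = 0.
    move=> /andP[lti lei] /andP[ltj lej].
    have [ltij|ltji|->] := ltngtP i j; last exact: lie_alt.
      have [lejp|ltpj] := leqP j p; first by rewrite comm ?lti ?ltij.
      by rewrite lie_ladder_big.
    rewrite lieC; have [lejp|ltpj] := leqP i p;
      first by rewrite comm ?ltj ?ltji ?oppr0.
    by rewrite lie_ladder_big ?oppr0.
  move=> v w v2 w2; rewrite -(combK bx v) -(combK bx w) /comb linear_sumlz
    big_nat big1 //.
  move=> i /andP[i0 lei]; rewrite linearZl_LR /=.
  have [lti|le2] := ltnP 2 i; last by rewrite (coords_lcs _ v2) ?i0 // scale0r.
  rewrite linear_sumr big_nat big1 /= ?scaler0 //.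
  move=> j /andP[j0 lej]; rewrite linearZr_LR /=.
  have [ltj|le2] := ltnP 2 j; last by rewrite (coords_lcs _ w2) ?j0 // scale0r.
  by rewrite comm' ?scaler0 ?lti ?ltj.
Qed.

(** This form of the Jacobi identity computes the brackets of the basis from those
    with x_2. *)
Lemma lie_ladder_step i j :
  [< x i.+3, x j.+2 >] = [< x1, [< x i.+2, x j.+2 >] >] - [< x i.+2, x j.+3 >].
Proof. by rewrite !ladderSS lie_lie. Qed.

Lemma lie_ladder_lcs i j : [< x i.+3, x j.+2 >] \in lcs g j.+3.
Proof.
rewrite lie_ladder_step memvB //.
  by apply: (@memv_lcs _ _ j.+2) => //; apply: (@memv_lcs _ _ j.+1) => //;
    exact: ladder_lcs.
by apply: (@memv_lcs _ _ j.+2) => //; exact: ladder_lcs.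
Qed.

Lemma novikov_dim_le5 : (p <= 4)%N -> admits_novikov_structure g.
Proof.
move=> lep; apply: metabelian_adapted => i j /andP[lt2i ltij] lejp.
case: i lt2i ltij => [|[|[|i]]] // _;
  case: j lejp => [|[|[|[|j]]]] // lejp ltij.
apply: (@lcs_big j.+4.+1); [lia | exact: lie_ladder_lcs].
Qed.
End Classification.

Section BracketTables.
Variables (F : numFieldType) (g : lieAlgebra F) (x : nat -> g).
Implicit Types (a b c d : F).

Lemma comb6E (u : nat -> F) : comb 6 x u = u 1%N *: x 1%N + u 2%N *: x 2%N
  + u 3%N *: x 3%N + u 4%N *: x 4%N + u 5%N *: x 5%N + u 6%N *: x 6%N.
Proof. by rewrite /comb 6?big_ltn // big_geq // addr0 !addrA. Qed.

Lemma comb7E (u : nat -> F) : comb 7 x u = u 1%N *: x 1%N + u 2%N *: x 2%N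
  + u 3%N *: x 3%N + u 4%N *: x 4%N + u 5%N *: x 5%N + u 6%N *: x 6%N
  + u 7%N *: x 7%N.
Proof. by rewrite /comb 7?big_ltn // big_geq // addr0 !addrA. Qed.

Lemma bracket6_of_basis a b c : is_basis 6 x ->
  (forall i, (1 < i < 6)%N -> [< x 1%N, x i >] = x i.+1) ->
  [< x 1%N, x 6%N >] = 0 ->
  [< x 2%N, x 3%N >] = a *: x 5%N + b *: x 6%N ->
  [< x 2%N, x 4%N >] = a *: x 6%N ->
  [< x 2%N, x 5%N >] = c *: x 6%N ->
  [< x 3%N, x 4%N >] = - c *: x 6%N ->
  (forall i j, (1 < i < j)%N -> (7 < i + j)%N -> (j <= 6)%N ->
    [< x i, x j >] = 0) ->
  has_bracket x 6 (bracket6 a b c).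
Proof.
move=> bx h1 h16 h23 h24 h25 h34 h0; split=> // v w.
rewrite (lie_eq_coord_mul bx (@bracket6_bilinear F a b c)) //.
  by move=> s t k; case: k => [|[|[|[|[|[|[|k]]]]]]]; rewrite /bracket6; ring.
move=> {v w} i j i_gt0 /andP[ltij lej]; rewrite comb6E /bracket6 /unitc.
case: i i_gt0 ltij => [|[|[|[|[|[|i]]]]]] // _;
  case: j lej => [|[|[|[|[|[|[|j]]]]]]] //= _ _;
  rewrite ?h16 ?h1 ?h23 ?h24 ?h25 ?h34 ?h0 //; vring.
Qed.

Lemma bracket7_of_basis a b c d : is_basis 7 x ->
  (forall i, (1 < i < 7)%N -> [< x 1%N, x i >] = x i.+1) ->
  [< x 2%N, x 3%N >] = a *: x 5%N + b *: x 6%N + c *: x 7%N ->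
  [< x 2%N, x 4%N >] = a *: x 6%N + b *: x 7%N ->
  [< x 2%N, x 5%N >] = d *: x 7%N ->
  [< x 3%N, x 4%N >] = (a - d) *: x 7%N ->
  (forall i j, (0 < i < j)%N -> (7 < i + j)%N -> (j <= 7)%N ->
    [< x i, x j >] = 0) ->
  has_bracket x 7 (bracket7 a b c d).
Proof.
move=> bx h1 h23 h24 h25 h34 h0; have h17 := h0 1%N 7 isT isT isT;
  split=> // v w.
rewrite (lie_eq_coord_mul bx (@bracket7_bilinear F a b c d)) //.
  by move=> s t k; case: k => [|[|[|[|[|[|[|[|k]]]]]]]]; rewrite /bracket7;
    ring.
move=> {v w} i j i_gt0 /andP[ltij lej]; rewrite comb7E /bracket7 /unitc.
case: i i_gt0 ltij => [|[|[|[|[|[|[|i]]]]]]] // _;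
  case: j lej => [|[|[|[|[|[|[|[|j]]]]]]]] //= _ _;
  rewrite ?h17 ?h1 ?h23 ?h24 ?h25 ?h34 ?h0 //; vring.
Qed.
End BracketTables.

Section Dimension67.
Variables (F : numFieldType) (g : lieAlgebra F) (x1 x2 : g).
Local Notation x := (ladder x1 x2).
Local Arguments ladder : simpl never.

Lemma filiform6_bracket : \dim {:g} = 6 -> nilpotency_class g 5 ->
  adapted x1 x2 ->
  exists a b c, has_bracket x 6 (bracket6 a b c).
Proof.
move=> dimg class5 x12.
have x_big := @lie_ladder_big F g 5 x1 x2 isT class5.
have [a [u u5]] := lcs_head x12 (isT : 1 < 4)%N (let: And3 _ _ h := x12 in h).
have [b [u' u6 ->]] := lcs_head x12 (isT : 1 < 5)%N u5.
rewrite (lcs_big class5 (isT : 5 < 6)%N u6) addr0 => h23.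
have : [< x 2%N, x 5%N >] \in lcs g 5 by apply: (@memv_lcs _ _ 4) => //;
  exact: (ladder_lcs _ _ 3).
case/(lcs_head x12 (isT : 1 < 5)%N) => c [u'' u7].
rewrite (lcs_big class5 (isT : 5 < 6)%N u7) addr0 => h25.
have step i j := lie_ladder_step x1 x2 i j.
have h24 : [< x 2%N, x 4%N >] = a *: x 6%N.
  have := step 0%N 1%N; rewrite lie_alt [X in [< x1, X >]]h23.
  rewrite linearDr !linearZr_LR /= (x_big x1 6%N) // scaler0 addr0 => /esym/eqP.
  by rewrite subr_eq0 => /eqP <-.
have h34 : [< x 3%N, x 4%N >] = - c *: x 6%N.
  rewrite (step 0%N 2%N) [X in [< x1, X >]]h24 h25 linearZr_LR /= x_big //;
    vring.
have h35 : [< x 3%N, x 5%N >] = 0.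
  by rewrite (step 0%N 3%N) h25 linearZr_LR /= !x_big // scaler0 subr0.
have h45 : [< x 4%N, x 5%N >] = 0.
  by rewrite (step 1%N 3%N) h35 linear0r x_big // subr0.
exists a, b, c; apply: bracket6_of_basis => //.
- exact: (ladder_basis _ dimg class5 x12).
- by case=> [|[|i]].
- exact: x_big.
- move=> i j; case: j => [|[|[|[|[|[|[|j]]]]]]] //;
  rewrite ?ltnS ?ltn0 ?andbF //=.
  all: case: i => [|[|[|[|[|[|i]]]]]] //= _ _ _; rewrite ?x_big //.
Qed.

(** A priori [x_2, x_5] also has a component e along x_6. Then
    [x_3, x_4], [x_3, x_5], [x_2, x_6] have the components - e, - e, 2 e along
    x_6, x_7, x_7, and the Jacobi identity for x_2, x_3, x_4 gives 2 e^2 = 0. *)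
Lemma filiform7_bracket : \dim {:g} = 7 -> nilpotency_class g 6 ->
  adapted x1 x2 ->
  exists a b c d, has_bracket x 7 (bracket7 a b c d).
Proof.
move=> dimg class6 x12.
have bx : is_basis 7 x by exact: (ladder_basis _ dimg class6 x12).
have x_big := @lie_ladder_big F g 6 x1 x2 isT class6.
have [a [u u5]] := lcs_head x12 (isT : 1 < 4)%N (let: And3 _ _ h := x12 in h).
have [b [u' u6 ->]] := lcs_head x12 (isT : 1 < 5)%N u5.
have [c [u'' u7 ->]] := lcs_head x12 (isT : 1 < 6)%N u6.
rewrite (lcs_big class6 (isT : 6 < 7)%N u7) addr0 addrA => h23.
have : [< x 2%N, x 5%N >] \in lcs g 5 by apply: (@memv_lcs _ _ 4) => //;
  exact: (ladder_lcs _ _ 3).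
case/(lcs_head x12 (isT : 1 < 5)%N) => e [t t6].
have [d [t' t7 ->]] := lcs_head x12 (isT : 1 < 6)%N t6.
rewrite (lcs_big class6 (isT : 6 < 7)%N t7) addr0 => h25.
have step i j := lie_ladder_step x1 x2 i j.
have h24 : [< x 2%N, x 4%N >] = a *: x 6%N + b *: x 7%N.
  have := step 0%N 1%N; rewrite lie_alt [X in [< x1, X >]]h23.
  rewrite !linearDr !linearZr_LR /= (x_big x1 7%N) // scaler0 addr0 =>
    /esym/eqP.
  by rewrite subr_eq0 => /eqP <-.
have h34 : [< x 3%N, x 4%N >] = (a - d) *: x 7%N - e *: x 6%N.
  rewrite (step 0%N 2%N) [X in [< x1, X >]]h24 h25 linearDr !linearZr_LR /=.
  rewrite (x_big x1 7%N) // -[[< x1, x 6%N >]]/(x 7%N); vring.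
have h35 : [< x 3%N, x 5%N >] = - e *: x 7%N.
  have := step 1%N 2%N; rewrite lie_alt [X in [< x1, X >]]h34.
  rewrite linearDr linearNr !linearZr_LR /= (x_big x1 7%N) // scaler0 add0r =>
    /esym/eqP.
  by rewrite subr_eq0 scaleNr => /eqP <-.
have h26 : [< x 2%N, x 6%N >] = (e + e) *: x 7%N.
  have := step 0%N 3%N; rewrite h35 [X in [< x1, X >]]h25 linearDr !linearZr_LR
    /=.
  rewrite (x_big x1 7%N) // -[[< x1, x 6%N >]]/(x 7%N) => h.
  by apply: (eq_of_multiple (k := 1) h); vring.
have h36 : [< x 3%N, x 6%N >] = 0.
  by rewrite (step 0%N 4%N) [X in [< x1, X >]]h26 linearZr_LR /= !x_big //
    scaler0 subr0.
have h45 : [< x 4%N, x 5%N >] = 0.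
  by rewrite (step 1%N 3%N) h35 h36 linearZr_LR /= x_big // scaler0 subr0.
have h46 : [< x 4%N, x 6%N >] = 0.
  by rewrite (step 1%N 4%N) h36 linear0r x_big // subr0.
have h56 : [< x 5%N, x 6%N >] = 0.
  by rewrite (step 2%N 4%N) h46 linear0r x_big // subr0.
have x7_neq0 : x 7%N != 0.
  apply/eqP => x70; have := @coords_basis F g 7 x bx 7 7 isT isT.
  have -> : coords 7 x (x 7%N) 7 = 0 by rewrite x70 /coords;
    case: insub => // k; exact: linear0.
  by move/esym/eqP; rewrite /unitc eqxx oner_eq0.
have e0 : e = 0.
  have := lie_lie (x 2%N) (x 3%N) (x 4%N).
  rewrite [X in [< X, x 4%N >]]h23 [X in [< x 2%N, X >]]h34
    [X in [< x 3%N, X >]]h24.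
  rewrite !linearDl !linearZl_LR !linearDr linearNr !linearZr_LR /=.
  rewrite (lieC (x 4%N) (x 5%N)) (lieC (x 4%N) (x 6%N)) (lieC (x 4%N) (x 7%N)).
  rewrite h45 h46 h36 h26 !x_big // => h.
  have /eqP : (e * e + e * e) *: x 7%N = 0 by apply:
    (eq_of_multiple (k := 1) h); vring.
  rewrite scaler_eq0 (negPf x7_neq0) orbF -mulr2n mulrn_eq0 mulf_eq0 orbb /=.
  by move/eqP.
exists a, b, c, d; rewrite e0 in h25 h26 h34 h35 *;
  apply: bracket7_of_basis => //.
- by case=> [|[|i]].
- by rewrite h25 scale0r add0r.
- by rewrite h34 scale0r subr0.
- move=> i j; case: j => [|[|[|[|[|[|[|[|j]]]]]]]] //;
  rewrite ?ltnS ?ltn0 ?andbF //=.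
  all: case: i => [|[|[|[|[|[|[|i]]]]]]] //= _ _ _; rewrite ?(x_big _ 7%N) //.
  all: by rewrite ?h26 ?h35 ?addr0 ?oppr0 scale0r.
Qed.
End Dimension67.

(** * Changes of basis in dimension 7 *)

Lemma isomorphic_of_bracket (F : numFieldType) (g h : lieAlgebra F)
    (x : nat -> g) (y : nat -> h) n br : bilinear_coords n br ->
  has_bracket x n br -> has_bracket y n br -> lie_isomorphic g h.
Proof.
move=> brP [bx xE] [by_ yE].
have flin : linear (fun v : g => comb n y (coords n x v)).
  by move=> c u v; rewrite -combP; apply: eq_comb => k _; rewrite coordsP.
pose fM := GRing.isLinear.Build F g h _ (fun v : g => comb n y (coords n x v))
  flin.
pose f : {linear g -> h} := HB.pack (fun v : g => comb n y (coords n x v)) fM.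
exists f; split.
  exists (fun w => comb n x (coords n y w)) => v; rewrite /f /=.
    by rewrite -[RHS](combK bx); apply: eq_comb => k lk; rewrite coords_comb.
  by rewrite -[RHS](combK by_); apply: eq_comb => k lk; rewrite coords_comb.
move=> v w; rewrite /f /= xE yE; apply: eq_comb => k lk; rewrite coords_comb //.
by apply: (eq_bilinear_coords brP) => // i li; rewrite coords_comb.
Qed.

Lemma triangular_basis (F : numFieldType) (g : lieAlgebra F) (x : nat -> g) n
    (Y : nat -> nat -> F) : is_basis n x ->
  (forall i k, (0 < k < i)%N -> Y i k = 0) ->
    (forall i, (0 < i <= n)%N -> Y i i != 0) ->
  is_basis n (fun i => comb n x (Y i)).
Proof.
move=> bx Y0 Yd; pose y i := comb n x (Y i).
rewrite /is_basis basisEdim size_tuple (size_basis bx) leqnn andbT.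
pose S := <<basis_tuple n y>>%VS.
have yS i : (0 < i <= n)%N -> y i \in S.
  case: i => // i ltin; apply: memv_span.
  by rewrite -(basis_tuple_nth y ltin) mem_nth // size_tuple.
have xS m i : (0 < i <= n)%N -> (n < i + m)%N -> x i \in S.
  elim: m i => [|m IHm] i /andP[i0 lei]; first by rewrite addn0 ltnNge lei.
  move=> ltm; have li : (0 < i <= n)%N by rewrite i0.
  have := yS i li; rewrite /y /comb (bigD1_seq i) ?mem_index_iota ?iota_uniq
    //=.
  have sS : \sum_(1 <= k < n.+1 | k != i) Y i k *: x k \in S.
    rewrite big_seq_cond; apply: memv_suml => k /andP[].
    rewrite mem_index_iota ltnS => /andP[k0 lek] neki.
    have [ltki|leik] := ltnP k i; first by rewrite Y0 ?k0 // scale0r mem0v.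
    apply: memvZ; apply: IHm; first by rewrite k0.
    by have ltik : (i < k)%N by [rewrite ltn_neqAle eq_sym neki]; lia.
  rewrite rpredDr // => /(memvZ (Y i i)^-1).
  by rewrite scalerA mulVf ?Yd // scale1r.
apply/subvP => v _; rewrite -(combK bx v) /comb big_nat;
  apply: memv_suml => i li.
apply: memvZ; apply: (xS n i li); case/andP: li => i0 _; lia.
Qed.

Section Normalization.
Variables (F : numFieldType) (g : lieAlgebra F) (x : nat -> g).

(** Coordinates of y_1 = x_1 + s x_2, y_2 = (x_2 + q x_4) / a,
    y_(k+1) = [y_1, y_k] in the algebra with the parameters a, b, c, d. *)
Definition shifted_ladder (a s q d : F) (i k : nat) : F :=
  let b := s * a ^+ 2 *+ 2 in
  let c := s ^+ 2 * a ^+ 3 *+ 4 + s ^+ 2 * a ^+ 2 * d + q * (a - d) *+ 2 in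
  nth 0 match i with
  | 1%N => [:: 0; 1; s]
  | 2%N => [:: 0; 0; a^-1; 0; q / a]
  | 3%N => [:: 0; 0; 0; a^-1; 0; q / a; s * q; s * q * b / a]
  | 4%N => [:: 0; 0; 0; 0; a^-1; s; (q + s * b) / a;
               (s * q * a + s * c + s * q * d) / a]
  | 5%N => [:: 0; 0; 0; 0; 0; a^-1; s *+ 2;
               (q + s * b *+ 2 + s ^+ 2 * a * d) / a]
  | 6%N => [:: 0; 0; 0; 0; 0; 0; a^-1; s *+ 2 + s * d / a]
  | 7%N => [:: 0; 0; 0; 0; 0; 0; 0; a^-1]
  | _ => [::]
  end k.

(** The constants b and c on the left are those which s and q remove: comparing
    [y_2, y_3] with y_5, the coefficients of x_6 agree when b = 2 s a^2 and then
    those of x_7 when c is as stated. When a <> 0 and a <> d, every b and c arise. *)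
Lemma normal_bracket7 a s q d : a != 0 ->
  has_bracket x 7 (bracket7 a (s * a ^+ 2 *+ 2)
    (s ^+ 2 * a ^+ 3 *+ 4 + s ^+ 2 * a ^+ 2 * d + q * (a - d) *+ 2) d) ->
  exists y, @has_bracket F g y 7 (bracket7 1 0 0 (d / a)).
Proof.
move=> a0 [bx xE]; pose Y := shifted_ladder a s q d.
exists (fun i => comb 7 x (Y i)).
set b := s * _ *+ 2 in xE; set c := _ + _ + _ in xE.
have lieY i j u : (forall k, (0 < k <= 7)%N ->
  bracket7 a b c d (Y i) (Y j) k = u k) ->
    [< comb 7 x (Y i), comb 7 x (Y j) >] = comb 7 x u.
  move=> uE; rewrite xE; apply: eq_comb => k lk; rewrite -uE //.
  by apply: (eq_bilinear_coords (@bracket7_bilinear F a b c d)) => // l ll;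
    rewrite coords_comb.
have comb0 : comb 7 x (fun _ => 0) = 0 by rewrite /comb big1 // => k _;
  rewrite scale0r.
have combZ r u : r *: comb 7 x u = comb 7 x (fun k => r * u k).
  by rewrite /comb scaler_sumr; apply: eq_bigr => k _; rewrite scalerA.
apply: bracket7_of_basis.
- apply: triangular_basis => //.
    by move=> i k; case: i => [|[|[|[|[|[|[|[|i]]]]]]]];
      case: k => [|[|[|[|[|[|[|[|k]]]]]]]].
  by move=> i; case: i => [|[|[|[|[|[|[|[|i]]]]]]]] //= _;
    rewrite ?oner_eq0 ?invr_eq0.
- move=> i li; apply: lieY => k.
  case: i li => [|[|[|[|[|[|[|i]]]]]]] //= _;
  case: k => [|[|[|[|[|[|[|[|k]]]]]]]] //= _;
  rewrite /bracket7 /Y /shifted_ladder /= ?/c /b; by field.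
- rewrite scale1r !scale0r !addr0; apply: lieY => k.
  case: k => [|[|[|[|[|[|[|[|k]]]]]]]] //= _;
  rewrite /bracket7 /Y /shifted_ladder /= ?/c /b; by field.
- rewrite scale1r !scale0r !addr0; apply: lieY => k.
  case: k => [|[|[|[|[|[|[|[|k]]]]]]]] //= _;
  rewrite /bracket7 /Y /shifted_ladder /= ?/c /b; by field.
- rewrite combZ; apply: lieY => k.
  case: k => [|[|[|[|[|[|[|[|k]]]]]]]] //= _;
  rewrite /bracket7 /Y /shifted_ladder /= ?/c /b; by field.
- rewrite combZ; apply: lieY => k.
  case: k => [|[|[|[|[|[|[|[|k]]]]]]]] //= _;
  rewrite /bracket7 /Y /shifted_ladder /= ?/c /b; by field.
- move=> i j /andP[i0 ltij] lt7 lej; rewrite -comb0; apply: lieY => k.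
  case: j ltij lt7 lej => [|[|[|[|[|[|[|[|j]]]]]]]] //;
  case: i i0 => [|[|[|[|[|[|[|i]]]]]]] //= _ _ _ _;
  case: k => [|[|[|[|[|[|[|[|k]]]]]]]] //= _;
  rewrite /bracket7 /Y /shifted_ladder /= ?/c /b; by field.
Qed.
End Normalization.

(** * The family g_I *)

Lemma gI_has_bracket (F : numFieldType) (a : F) :
  @has_bracket F (gI a) (@gI_basis F) 7 (bracket7 1 0 0 (1 - a)).
Proof.
have lie_x i j : (0 < i < j)%N -> (j <= 7)%N ->
    [< gI_basis F i : gI a, gI_basis F j : gI a >] = gI_table a i j.
  exact: gI_bracket_basis.
apply: bracket7_of_basis.
- rewrite /is_basis basisEdim size_tuple dimvf /= dim_matrix leqnn andbT.
  apply/subvP => v _; rewrite (row_sum_delta v); apply: memv_suml => i _.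
  apply: memvZ; apply: memv_span.
  have -> : delta_mx 0 i = (basis_tuple 7 (gI_basis F : nat -> gI a))`_i.
    by rewrite basis_tuple_nth // /gI_basis /= inord_val.
  by rewrite mem_nth // size_tuple.
- by case=> [|[|[|[|[|[|[|i]]]]]]] // _; rewrite lie_x.
- by rewrite lie_x //= scale1r !scale0r !addr0.
- by rewrite lie_x //= scale1r !scale0r !addr0.
- by rewrite lie_x.
- by rewrite lie_x //= opprB addrCA subrr addr0.
- move=> i j lij lt7 lej; rewrite lie_x //.
  case: j lij lt7 lej => [|[|[|[|[|[|[|[|j]]]]]]]] //; rewrite ?andbF //;
  by case: i => [|[|[|[|[|[|[|i]]]]]]].
Qed.

Lemma eq_of_scaled (F : fieldType) (k u v w z : F) :
  w = z -> u - v = k * (w - z) -> u = v.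
Proof. exact: (@eq_of_multiple F F^o). Qed.

Section HalfDerivations.
Variables (F : numFieldType) (a : F).
Local Notation br := (bracket7 1 0 0 (1 - a)).

(** Coordinates of the image of x_(n+2) under a half derivation with x_1 mapped to
    P and x_2 to Q, from x_(n+3) = [x_1, x_(n+2)]. *)
Fixpoint half_coords (P Q : nat -> F) (n k : nat) : F :=
  if n is n'.+1 then
    (br P (unitc F n.+1) k + br (unitc F 1) (half_coords P Q n') k) / 2%:R
  else Q k.

Variables (g : lieAlgebra F) (x : nat -> g).
Hypothesis gx : has_bracket x 7 br.
Variable D : g -> g.
Hypothesis half_D : forall v w, D [< v, w >] + D [< v, w >] = [< D v, w >] +
  [< v, D w >].

Local Notation coords := (coords 7 x).
Let bx : is_basis 7 x := proj1 gx.
Let P := coords (D (x 1%N)).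
Let Q := coords (D (x 2%N)).

Lemma coords_lie v w k : (0 < k <= 7)%N ->
  coords [< v, w >] k = br (coords v) (coords w) k.
Proof. by move=> lk; rewrite gx.2 coords_comb. Qed.

Lemma lie_x_table i j : (0 < i <= 7)%N -> (0 < j <= 7)%N ->
  [< x i, x j >] = comb 7 x (br (unitc F i) (unitc F j)).
Proof.
move=> li lj; rewrite gx.2; apply: eq_comb => k lk.
by apply: (eq_bilinear_coords (@bracket7_bilinear F _ _ _ _)) => // l ll;
  rewrite coords_basis.
Qed.

Lemma lie_x_unit i j m : (0 < i <= 7)%N -> (0 < j <= 7)%N -> (0 < m <= 7)%N ->
  (forall k, (0 < k <= 7)%N -> br (unitc F i) (unitc F j) k = unitc F m k) ->
  [< x i, x j >] = x m.
Proof.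
move=> li lj lm h; rewrite lie_x_table // -[RHS](combK bx);
  apply: eq_comb => k lk.
by rewrite coords_basis // h.
Qed.

Lemma lie_x1 i : (1 < i < 7)%N -> [< x 1%N, x i >] = x i.+1.
Proof.
move=> li; apply: lie_x_unit; [by []|lia|lia|].
move=> k lk; case: i li => [|[|[|[|[|[|[|i]]]]]]] //= _;
case: k lk => [|[|[|[|[|[|[|[|k]]]]]]]] //= _; rewrite /bracket7 /unitc /=;
  ring.
Qed.

Lemma lie_x23 : [< x 2%N, x 3%N >] = x 5%N.
Proof.
apply: lie_x_unit => // k.
case: k => [|[|[|[|[|[|[|[|k]]]]]]]] //= _; rewrite /bracket7 /unitc /=; ring.
Qed.

Lemma lie_x24 : [< x 2%N, x 4%N >] = x 6%N.
Proof.
apply: lie_x_unit => // k.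
case: k => [|[|[|[|[|[|[|[|k]]]]]]]] //= _; rewrite /bracket7 /unitc /=; ring.
Qed.

Lemma half_lie i j m k : (0 < k <= 7)%N -> (0 < i <= 7)%N -> (0 < j <= 7)%N ->
  [< x i, x j >] = x m ->
  coords (D (x m)) k *+ 2 = br (coords (D (x i))) (unitc F j) k + br (unitc F i)
    (coords (D (x j))) k.
Proof.
move=> lk li lj xm; rewrite mulr2n -coordsD -xm half_D coordsD !coords_lie //.
by congr (_ + _); apply: (eq_bilinear_coords (@bracket7_bilinear F _ _ _ _)) =>
  // l ll;
  rewrite coords_basis.
Qed.

Lemma half_coordsE n k : (n < 6)%N -> (0 < k <= 7)%N ->
  coords (D (x n.+2)) k = half_coords P Q n k.
Proof.
elim: n k => [//|n IHn] k ltn lk /=.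
have two0 : (2%:R : F) != 0 by rewrite pnatr_eq0.
apply: (mulIf two0); rewrite divfK // mulr_natr.
rewrite (@half_lie 1 n.+2 n.+3) ?lie_x1 ?ltnS // ?(ltnW ltn) //; last by lia.
congr (_ + _); apply: (eq_bilinear_coords (@bracket7_bilinear F _ _ _ _)) =>
  // l ll.
by rewrite IHn // ltnW.
Qed.

(** Two values can be computed for D x_5, from [x_1, x_4] and [x_2, x_3], and two
    for D x_6. Their coordinates at x_4, ..., x_7 compare the parts of D of degree
    -1, 0, 1, 2 for D x_5, and the one at x_7 that of degree 1 for D x_6. *)
Lemma half_derivation_gI :
  [/\ Q 1%N = 0, Q 2%N = P 1%N, Q 3%N = 6%:R * P 2%N, P 2%N * (1 - 10%:R * a) =
    0
    & P 3%N * (1 + 2%:R * a) = Q 4%N * (1 - 6%:R * a)].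
Proof.
have e23 k : (0 < k <= 7)%N -> half_coords P Q 3 k *+ 2 =
    br Q (unitc F 3) k + br (unitc F 2) (half_coords P Q 1) k.
  move=> lk; rewrite -half_coordsE // (@half_lie 2 3 5) ?lie_x23 //.
  congr (_ + _); apply: (eq_bilinear_coords (@bracket7_bilinear F _ _ _ _)) =>
    // l ll.
  by rewrite half_coordsE.
have e24 k : (0 < k <= 7)%N -> half_coords P Q 4 k *+ 2 =
    br Q (unitc F 4) k + br (unitc F 2) (half_coords P Q 2) k.
  move=> lk; rewrite -half_coordsE // (@half_lie 2 4 6) ?lie_x24 //.
  congr (_ + _); apply: (eq_bilinear_coords (@bracket7_bilinear F _ _ _ _)) =>
    // l ll.
  by rewrite half_coordsE.
have Q1 : Q 1%N = 0.
  apply: (eq_of_scaled (k := -1) (e23 4%N isT)).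
  by rewrite /half_coords /bracket7 /unitc /=; field.
have Q3 : Q 3%N = 6%:R * P 2%N.
  apply: (eq_of_scaled (k := (- 4%:R)) (e23 6%N isT)).
  by rewrite /half_coords /bracket7 /unitc /=; field.
split=> //.
- apply: (eq_of_scaled (k := (- (4%:R / 5%:R))) (e23 5%N isT)).
  by rewrite /half_coords /bracket7 /unitc /=; field.
- apply: (eq_of_scaled (k := 2%:R) (e24 7%N isT)).
  by rewrite /half_coords /bracket7 /unitc /= Q3; field.
- apply: (eq_of_scaled (k := 4%:R) (e23 7%N isT)).
  by rewrite /half_coords /bracket7 /unitc /=; field.
Qed.
End HalfDerivations.

Section Necessity.
Variables (F : numFieldType) (a : F) (g : lieAlgebra F) (x : nat -> g).
Hypothesis gx : has_bracket x 7 (bracket7 1 0 0 (1 - a)).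
Hypothesis a_neq0 : a != 0.
Let bx : is_basis 7 x := proj1 gx.

(** Here r i w holds the coordinates of x_i x_w. The relations
    x_i x_j - x_j x_i = [x_i, x_j] transfer information between the right
    multiplications. *)
Lemma novikov_parameter : admits_novikov_structure g -> a = 1 / 10%:R.
Proof.
case=> mul nov; have halfR w := novikov_half_derivation nov w.
have [_ rcomm brE] := nov.
have [//|a10] := eqVneq a (1 / 10%:R); exfalso.
have a10' : 1 - 10%:R * a != 0.
  apply: contraNneq a10 => h.
  have -> : a = (1 - (1 - 10%:R * a)) / 10%:R by field.
  by rewrite h subr0.
pose r i w := coords 7 x (mul (x i) (x w)).
have rE n w k := half_coordsE (D := fun v => mul v (x w)) gx (halfR (x w))
  (n := n) (k := k).
have hd w := half_derivation_gI (D := fun v => mul v (x w)) gx (halfR (x w)).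
have {hd} hd w : [/\ r 1%N w 2%N = 0, r 2%N w 1%N = 0, r 2%N w 2%N = r 1%N w
  1%N,
    r 2%N w 3%N = 0
  & r 1%N w 3%N * (1 + 2%:R * a) = r 2%N w 4%N * (1 - 6%:R * a)].
  have [h1 h2 h3 /eqP h4 h5] := hd w.
  move: h4; rewrite mulf_eq0 (negPf a10') orbF => /eqP h4.
  by split=> //; rewrite /r h3 h4 mulr0.
have rC i j m k : (0 < k <= 7)%N -> [< x i, x j >] = x m -> (0 < m <= 7)%N ->
    r i j k = r j i k + unitc F m k.
  move=> lk xm lm; rewrite /r -(coords_basis bx lm lk) -xm brE.
  by rewrite -coordsD addrC subrK.
have r12 k : (0 < k <= 7)%N -> r 1%N 2%N k = r 2%N 1%N k + unitc F 3 k.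
  by move=> lk; apply: rC => //; apply: (lie_x1 gx).
have r13 k : (0 < k <= 7)%N -> r 1%N 3%N k = r 3%N 1%N k + unitc F 4 k.
  by move=> lk; apply: rC => //; apply: (lie_x1 gx).
have r23 k : (0 < k <= 7)%N -> r 2%N 3%N k = r 3%N 2%N k + unitc F 5 k.
  by move=> lk; apply: rC => //; apply: (lie_x23 gx).
have rE' n w k : (n < 6)%N -> (0 < k <= 7)%N ->
    r n.+2 w k = half_coords a (r 1%N w) (r 2%N w) n k by exact: rE.
have r3E w k := rE' 1%N w k isT.
have [p12 q11 q12 q13 _] := hd 1%N; have [p22 q21 q22 q23 vE] := hd 2%N.
have [p32 q31 q32 q33 _] := hd 3%N.
have p21 : r 1%N 2%N 1%N = 0 by rewrite r12 // q11 /unitc addr0.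
have p23 : r 1%N 2%N 3%N = 1 by rewrite r12 // q13 /unitc add0r.
have p11 : r 1%N 1%N 1%N = 0 by rewrite -q12; move: (r12 2%N isT);
  rewrite p22 /unitc addr0.
have p31 : r 1%N 3%N 1%N = 0.
  by rewrite r13 // r3E //= /unitc /=; field.
have p33 : r 1%N 3%N 3%N = 0.
  by rewrite r13 // r3E //= /bracket7 /unitc /= p11 q12 p11; field.
have p34 : r 1%N 3%N 4%N = 1.
  by rewrite r13 // r3E //= /bracket7 /unitc /= p11 q13; field.
have q35 : r 2%N 3%N 5%N = (r 2%N 2%N 4%N + 1) / 2%:R.
  by rewrite r23 // r3E //= /bracket7 /unitc /= ?q21 ?p23 ?q22 ?p21 ?p22; field.
have q34 : r 2%N 3%N 4%N = 0.
  by rewrite r23 // r3E //= /bracket7 /unitc /= ?q21 ?q23 ?p23 ?q22 ?p21 ?p22;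
    field.
have coords_mulx v j : coords 7 x (mul v (x j)) 7 =
    \sum_(1 <= k < 8) coords 7 x v k * r k j 7%N.
  rewrite -[v in LHS](combK bx) /comb linear_sumlz coords_sum;
    apply: eq_bigr => k _.
  by rewrite linearZl_LR coordsZ.
have sum7 (f : nat -> F) : \sum_(1 <= k < 8) f k =
    f 1%N + f 2%N + f 3%N + f 4%N + f 5%N + f 6%N + f 7%N.
  by rewrite 7?big_ltn // big_geq // addr0 !addrA.
(* The coefficient of x_7 in (x_2 x_2) x_3 = (x_2 x_3) x_2. *)
have := congr1 (fun v => coords 7 x v 7) (rcomm (x 2%N) (x 2%N) (x 3%N)).
rewrite /= !coords_mulx !sum7 -![coords 7 x _ _]/(r 2%N _ _).
rewrite !(rE' 1%N) // !(rE' 2%N) // !(rE' 3%N) // !(rE' 4%N) // !(rE' 5%N) //.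
rewrite p23 mul1r in vE; set v := r 2%N 2%N 4%N in q35 vE * => assoc7.
have quadratic : (v - 1) ^+ 2 - 12%:R * a * (v - 1) - 16%:R * a = 0.
  apply: (eq_of_scaled (k := 16%:R) assoc7).
  rewrite /half_coords /bracket7 /unitc /= -!/v.
  rewrite q21 q22 p21 q23 q31 q32 p31 q33 q34 q35 ?p22 ?p23 ?p32 ?p33 ?p34 -?/v.
  by field.
have linear_rel : (v - 1) * (1 - 6%:R * a) = 8%:R * a.
  by apply: (eq_of_scaled (k := -1) vE); ring.
have v_neq1 : v - 1 != 0.
  apply: contra_neq a_neq0 => v1; move: linear_rel;
    rewrite v1 mul0r => /esym/eqP.
  by rewrite mulf_eq0 pnatr_eq0 /= => /eqP.
have v2 : v - 1 = 2%:R.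
  apply: (mulfI v_neq1); apply: (eq_of_scaled (k := 1) quadratic).
  have -> : 16%:R * a = 2%:R * (8%:R * a) by ring.
  by rewrite -linear_rel; ring.
case/eqP: a10; rewrite v2 in linear_rel.
by apply: (eq_of_scaled (k := - 1 / 20%:R) linear_rel); field.
Qed.
End Necessity.

(** * Existence of Novikov structures up to dimension 7 *)

Section Main.
Variable F : numFieldType.

Lemma filiform_novikov (g : lieAlgebra F) :
  filiform g -> (\dim {:g} <= 7)%N ->
  (forall a : F, a != 0 -> ~ lie_isomorphic g (gI a)) ->
  admits_novikov_structure g.
Proof.
case=> p dimg class_p; rewrite dimg ltnS => lep not_gI.
have p_gt0 : (0 < p)%N.
  rewrite lt0n; apply/negP => /eqP p0; have [nil_p _] := class_p; move: nil_p.
  by rewrite /step_nilpotent p0 /= => g0; move: dimg; rewrite p0 g0 dimv0.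
have [x1 [x2 x12]] := filiform_adapted p_gt0 dimg class_p.
have [le4|] := leqP p 4; first exact: novikov_dim_le5 x12 le4.
rewrite leq_eqVlt => /predU1P[p5|lt5].
  rewrite -p5 in dimg class_p.
  have [a [b [c gx]]] := filiform6_bracket dimg class_p x12.
  exact: novikov6 gx.
have p6 : p = 6%N by apply/eqP; rewrite eqn_leq lep.
rewrite p6 in dimg class_p;
  have [a [b [c [d gx]]]] := filiform7_bracket dimg class_p x12.
have [a0|a0] := eqVneq a 0; first by rewrite a0 in gx; exact: novikov7 gx.
have [ead|nead] := eqVneq a d.
  apply: (metabelian_adapted (p := 6) _ dimg class_p x12) =>
    // i j /andP[lti ltij] lej.
  have [bx lieE] := gx; rewrite lieE /comb big_nat big1 // => k lk.
  rewrite (eq_bilinear_coords (@bracket7_bilinear F a b c d) lk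
    (u' := unitc F i) (v' := unitc F j)); last 2 first.
  - by move=> l ll; rewrite coords_basis //; lia.
  - by move=> l ll; rewrite coords_basis //; lia.
  rewrite [X in X *: _](_ : _ = 0) ?scale0r // -ead.
  case: i j lti ltij lej => [|[|[|i]]] // [|[|[|j]]] // _ _ _.
  by case: k lk => [|[|[|[|[|[|[|[|k]]]]]]]] //= _; rewrite /bracket7 /unitc /=;
    ring.
have e0 : a - d != 0 by rewrite subr_eq0.
pose s := b / (2%:R * a ^+ 2).
pose q := (c - s ^+ 2 * a ^+ 3 *+ 4 - s ^+ 2 * a ^+ 2 * d) / (2%:R * (a - d)).
have bE : b = s * a ^+ 2 *+ 2 by rewrite /s; field.
have cE : c = s ^+ 2 * a ^+ 3 *+ 4 + s ^+ 2 * a ^+ 2 * d + q * (a - d) *+ 2.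
  by rewrite /q; field.
rewrite bE cE in gx; have [y gy] := normal_bracket7 a0 gx.
have alpha0 : (a - d) / a != 0 by rewrite mulf_neq0 ?invr_eq0.
case: (not_gI _ alpha0); apply: isomorphic_of_bracket gy _.
  exact: bracket7_bilinear.
have -> : d / a = 1 - (a - d) / a by field.
exact: gI_has_bracket.
Qed.
End Main.

Local Open Scope complex_scope.

Theorem proposition2p9 (R : realType) :
  (forall g : lieAlgebra R[i],
     filiform g -> (\dim {:g} <= 7)%N ->
     (forall a : R[i], a != 0 -> ~ lie_isomorphic g (gI a)) ->
     admits_novikov_structure g) /\
  (forall a : R[i], a != 0 ->
     (admits_novikov_structure (gI a) <-> a = 1 / 10%:R)).
Proof.
split; first exact: filiform_novikov.
move=> a a0; split; first exact: (novikov_parameter (gI_has_bracket a)).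
by move=> ->; exact: (novikov7_tenth (gI_has_bracket (1 / 10%:R))).
Qed.
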